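(* Fix an integer $m\ge1$ and a set $I$ with $\{(i,j,0): i+j=m\}\cup\{(0,0,m)\}\subset I\subset\mathcal M_{3,m}$. For $f(x,y)\in\mathbb{Z}[x,y]$ of degree $m$ let $F(x,y,z)=z^mf(x/z,y/z)$, let $I_f$ be the set of exponent vectors of monomials of $F$ having nonzero coefficient, and let $C_f$ be the projective curve $F=0$. Then for a positive proportion of $f(x,y)\in\mathbb{Z}[x,y]$ of degree $m$ with $I_f=I$ (ordered by the maximum absolute value of their coefficients, i.e. with positive lower density as this bound tends to infinity) we have $G(C_f)=m=G(H)$, where $H=\{(0,0,m),(0,m,0),(m,0,0)\}$ is the Newton polytope of every such $f$.
   Context: $\mathcal M_{3,m}=\{(i,j,k)\in\mathbb{Z}^3_{\ge0}: i+j+k=m\}$. $G(H)$ is the gcd of all coordinates of all elements of $H$. For a number field $L$, a point of $C_f$ over $L$ is new if it is non-singular and not defined over a proper subfield of $L$; $D(C_f)$ is the set of degrees $[L:\mathbb{Q}]$ of number fields $L$ over which $C_f$ has a new point, and $G(C_f)=\gcd D(C_f)$ is the index. *)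

(* Defs.v *)
From HB Require Import structures.
From mathcomp Require Import all_boot all_order all_algebra all_field.
From mathcomp Require Import mpoly.
Set Implicit Arguments. Unset Strict Implicit. Unset Printing Implicit Defensive.
Import Order.TTheory GRing.Theory Num.Theory.
Local Open Scope ring_scope.

Definition trip (m : nat) : finType := ('I_m.+1 * 'I_m.+1 * 'I_m.+1)%type.
Definition t1 {m} (t : trip m) : nat := t.1.1.
Definition t2 {m} (t : trip m) : nat := t.1.2.
Definition t3 {m} (t : trip m) : nat := t.2.

Definition M3 (m : nat) : {set trip m} :=
  [set t : trip m | (t1 t + t2 t + t3 t == m)%N].

Definition Gexp (m : nat) (H : {set trip m}) : nat :=
  \big[gcdn/0%N]_(t in H) gcdn (t1 t) (gcdn (t2 t) (t3 t)).

(* The homogeneous ternary form F(x,y,z) = z^m f(x/z,y/z) whose coefficient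
   of x^i y^j z^k is a (i,j,k) (only triples in M_{3,m} are used). *)
Definition Fform (m : nat) (a : trip m -> int) : {mpoly int[3]} :=
  \sum_(t in M3 m)
     (a t)%:MP * 'X_(0%R : 'I_3) ^+ t1 t * 'X_(1%R : 'I_3) ^+ t2 t
       * 'X_(2%R : 'I_3) ^+ t3 t.

Definition Isupp (m : nat) (a : trip m -> int) : {set trip m} :=
  [set t in M3 m | a t != 0].

Section Points.
Variable L : fieldExtType rat.

Definition mapF (F : {mpoly int[3]}) : {mpoly L[3]} := map_mpoly intr F.

(* v : L^3 \ {0} represents a point of P^2(L) lying on C_F : F = 0 *)
Definition on_curve (F : {mpoly int[3]}) (v : 'I_3 -> L) : Prop :=
  (exists i, v i != 0) /\ (mapF F).@[v] = 0.

Definition nonsingular (F : {mpoly int[3]}) (v : 'I_3 -> L) : Prop :=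
  exists i : 'I_3, (mapF (mderiv i F)).@[v] != 0.

Definition defined_over (K : {subfield L}) (v : 'I_3 -> L) : Prop :=
  exists lam : L, lam != 0 /\ forall i, lam * v i \in K.

Definition new_point (F : {mpoly int[3]}) (v : 'I_3 -> L) : Prop :=
  on_curve F v /\ nonsingular F v /\
  forall K : {subfield L}, K != fullv -> ~ defined_over K v.
End Points.

Definition Dset (F : {mpoly int[3]}) (d : nat) : Prop :=
  exists (L : fieldExtType rat) (v : 'I_3 -> L),
    new_point F v /\ d = \dim (fullv : {vspace L}).

Definition is_set_gcd (D : nat -> Prop) (g : nat) : Prop :=
  (forall d, D d -> (g %| d)%N) /\
  (forall e, (forall d, D d -> (e %| d)%N) -> (e %| g)%N).

(* Decoding of a bounded coefficient k in 'I_(2B+1) as the integer k - B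
   in [-B, B]. *)
Definition dec (B : nat) (k : 'I_(2 * B).+1) : int := (k : nat)%:Z - B%:Z.

Definition polys_with_support (m B : nat) (I : {set trip m})
  : {set {ffun trip m -> 'I_(2 * B).+1}} :=
  [set c : {ffun trip m -> 'I_(2 * B).+1} | Isupp (fun t => dec (c t)) == I &
           [forall t, (t \notin M3 m) ==> (dec (c t) == 0)]].
Arguments polys_with_support : clear implicits.

(* Main.v *)
(** Fix p = 2 and prescribe the coefficients modulo 4 so that f is congruent mod 2
    to a binary form g(x,y) which is irreducible of degree m over F_2, every
    coefficient of a monomial divisible by z is even, and that of z^m is 2 mod 4.
    The points at infinity (theta : 1 : 0) have degree m, so it remains to see that
    m divides [L : Q] for every point (x : y : z) over L.

    Extend the 2-adic valuation to a valuation ring V of algC, and measure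
    polynomials in T by their content with respect to V.  Let xi = z + xT + yT^2,
    whose content is that of (x,y,z), and let G be the top form of f.  Since
    F(x,y,z) = 0, G(x,y) is -2 times a form which is a unit where x and y vanish in
    the residue field, so that G(x + 2 xi, y) has content 2 content(xi)^m at every
    one of the n = [L : Q] embeddings.  Multiplying over the embeddings gives
    2^n e^m with e rational.  On the other hand G is a norm form: the same product
    is a product of D(theta) over the m roots theta of G(S,1), with D in Q[T][S],
    and as G(S,1) is irreducible mod 2 the content of D(theta) is a rational number
    independent of theta.  Hence 2^n is an m-th power up to units, and m divides n. *)

Require Import Defs.
From HB Require Import structures.
From mathcomp Require Import all_boot all_order all_algebra all_fingroup all_field.
From mathcomp Require Import mpoly ring zify.
From mathcomp Require boolp classical_sets.
Import Order.TTheory GRing.Theory Num.Theory.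
Local Open Scope ring_scope.
Set Implicit Arguments. Unset Strict Implicit. Unset Printing Implicit Defensive.

(** * Valuation rings of a field *)

(* The degree-lowering step of Chevalley's extension theorem. *)
Lemma inv_integral_exchange (K : fieldType) (V : subringClosed K) (p x y : K) :
    p \in V -> (forall a, a \in V -> (1 - p * a)^-1 \in V /\ 1 - p * a != 0) ->
    x * y = 1 -> forall g h : {poly K}, g \is a polyOver V ->
  h \is a polyOver V -> p * g.[x] = 1 -> p * h.[y] = 1 -> False.
Proof.
move=> Vp unitV xy1 g h Vg Vh gx hy.
have [N] := ubnP (size g + size h)%N.
elim: N => // N IHN in x y xy1 g h Vg Vh gx hy *.
wlog le_hg : x y xy1 g h Vg Vh gx hy / (size h <= size g)%N.
  move=> IH; case/orP: (leq_total (size h) (size g)) => le; first exact: (IH x y xy1 g h).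
  by rewrite addnC => ?; apply: (IH y x _ h g) => //; rewrite mulrC.
move=> leN.
have g_neq0 : g != 0 by apply/eqP=> g0; move/eqP: gx; rewrite g0 horner0 mulr0 eq_sym oner_eq0.
set k := (size g).-1.
have szg : size g = k.+1 by rewrite -polySpred.
have Vgi i : g`_i \in V by apply/polyOverP.
have Vhi i : h`_i \in V by apply/polyOverP.
have [Vu u0] := unitV _ (Vhi 0%N); set u := 1 - _ in Vu u0.
pose c i := (u^-1 * h`_i.+1).
have Vc i : c i \in V by rewrite rpredM.
(* The constant term of p h(y) = 1 goes to the right-hand side, where it becomes the unit [u];
   dividing by [u] leaves a relation without constant term. *)
have cy : p * (\sum_(j < k) c j * y ^+ j.+1) = 1.
  have: p * (\sum_(j < k) h`_j.+1 * y ^+ j.+1) = u.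
    move: hy; rewrite (@horner_coef_wide _ k.+1); last by rewrite -szg.
    rewrite big_ord_recl expr0 mulr1 mulrDr => e.
    by rewrite /u -e addrAC subrr add0r.
  move=> e; apply: (mulfI u0); rewrite mulr1 -[RHS]e mulrCA; congr (_ * _).
  by rewrite mulr_sumr; apply: eq_bigr => j _; rewrite /c mulrA mulrA divff // mul1r.
(* The leading term of g(x) is multiplied by the expression [cy] for 1. As x y = 1, each x^k y^(j+1)
   becomes x^(k-j-1), so the degree falls below k. *)
pose g' := \poly_(i < k) (g`_i + g`_k * p * c (k - i.+1)%N).
have Vg' : g' \is a polyOver V.
  by apply/polyOver_poly => i _; rewrite rpredD ?rpredM.
apply: (IHN x y xy1 g' h Vg' Vh _ hy); last first.
  rewrite szg addSn ltnS in leN.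
  by apply: leq_ltn_trans leN; rewrite leq_add2r size_poly.
suff -> : g'.[x] = g.[x] by [].
rewrite horner_poly [RHS]horner_coef szg big_ord_recr /=.
under eq_bigr do rewrite mulrDl.
rewrite big_split /=; congr (_ + _).
rewrite -[in RHS](mulr1 (x ^+ k)) -cy [RHS]mulrA !mulr_sumr.
rewrite [RHS](reindex_inj rev_ord_inj) /=; apply: eq_bigr => i _.
have ->: (x ^+ k = x ^+ i * x ^+ (k - i.+1).+1)%R.
  by rewrite -exprD; congr (_ ^+ _); have := ltn_ord i; lia.
have: x ^+ (k - i.+1).+1 * y ^+ (k - i.+1).+1 = 1 by rewrite -exprMn xy1 expr1n.
set X := x ^+ _.+1; set Y := y ^+ _.+1 => XY.
rewrite -[LHS]mulr1 -XY; ring.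
Qed.

(** By Zorn there is a subring maximal among those avoiding 1/p. Were x and x^-1 both outside it,
    adjoining either one would produce 1/p, which the exchange lemma excludes. *)
Lemma exists_valuation_ring (K : fieldType) (p : nat) :
    (forall z : int, z%:~R * p%:R != 1 :> K) -> p%:R != 0 :> K ->
  exists V : subringClosed K,
    p%:R^-1 \notin V /\ (forall x, x \in V \/ x^-1 \in V).
Proof.
move=> pZ p0; set pi : K := p%:R in p0 *.
(* The unit is asked only of a nonempty [A], so that the union of an empty chain is admissible;
   [A 1] is recovered afterwards by comparing [A] with the image of the integers. *)
pose P (A : K -> Prop) := [/\ forall x, A x -> A 1,
  forall x y, A x -> A y -> A (x - y), forall x y, A x -> A y -> A (x * y)
  & ~ A pi^-1].
have [|A [[A1 AB AM Ap] Amax]] := @classical_sets.Zorn_bigcup K P.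
  move=> F FP Ftot.
  have in2 x y : classical_sets.bigcup F id x -> classical_sets.bigcup F id y ->
      exists B, [/\ F B, B x & B y].
    move=> [B FB Bx] [C FC Cy]; case: (Ftot B C FB FC) => BC.
      by exists C; split=> //; apply: BC.
    by exists B; split=> //; apply: BC.
  split=> [x [B FB Bx]|x y Fx Fy|x y Fx Fy|[B FB Bx]].
  - by exists B => //; case: (FP B FB) => h _ _ _; apply: h Bx.
  - have [B [FB Bx By]] := in2 x y Fx Fy; exists B => //.
    by case: (FP B FB) => _ h _ _; apply: h.
  - have [B [FB Bx By]] := in2 x y Fx Fy; exists B => //.
    by case: (FP B FB) => _ _ h _; apply: h.
  - by case: (FP B FB) => _ _ _; apply.
have {}Amax (B : K -> Prop) : (forall x, A x -> B x) -> B 1 ->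
    (forall x y, B x -> B y -> B (x - y)) ->
    (forall x y, B x -> B y -> B (x * y)) ->
    (exists2 x, B x & ~ A x) -> B pi^-1.
  move=> AleB B1 BB BM [x Bx nAx]; apply: boolp.contrapT => nBp.
  apply: (Amax B); last by split.
  by split=> // BleA; apply/nAx/BleA.
have {}A1 : A 1.
  apply: boolp.contrapT => nA1.
  have [|||||z] // := Amax (fun x => exists z : int, x = z%:~R).
  - by move=> x /A1.
  - by exists 1.
  - by move=> _ _ [z ->] [t ->]; exists (z - t); rewrite rmorphB.
  - by move=> _ _ [z ->] [t ->]; exists (z * t); rewrite rmorphM.
  - by exists 1 => //; exists 1.
  - by move=> e; have := pZ z; rewrite -e mulVf ?eqxx.
pose V : {pred K} := fun x => boolp.asbool (A x).
have VP x : (x \in V) <-> A x by split=> /boolp.asboolP.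
have Vsub : subring_closed V.
  split=> [|x y|x y]; rewrite ?VP //; [exact: AB | exact: AM].
pose HV := GRing.isSubringClosed.Build K V Vsub.
pose W : subringClosed K := HB.pack V HV.
have WP x : (x \in W) <-> A x by exact: VP.
exists W; split; first by apply/negP=> /WP.
have Wpi : pi \in W by rewrite /pi rpred_nat.
have unit1 a : a \in W -> (1 - pi * a)^-1 \in W /\ 1 - pi * a != 0.
  have nz b : b \in W -> 1 - pi * b != 0.
    move=> Wb; apply/negP=> /eqP/subr0_eq e; apply/Ap/WP.
    by rewrite -[pi^-1]mulr1 e mulKf.
  move=> Wa; split; last exact: nz.
  apply: boolp.contrapT => nWa.
  (* The fractions c / (1 - p d) form a ring containing [W]. If 1/p were one of them, then 1/p = c +
     d would already lie in [W]. *)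
  have [|||||c [d [Wc Wd]]] // := Amax (fun x => exists c d,
      [/\ c \in W, d \in W & x = c / (1 - pi * d)]).
  - by move=> x /WP Wx; exists x, 0; rewrite rpred0 mulr0 subr0 divr1.
  - by exists 1, 0; rewrite rpred0 rpred1 mulr0 subr0 divr1.
  - move=> _ _ [c [d [Wc Wd ->]]] [c' [d' [Wc' Wd' ->]]].
    exists (c * (1 - pi * d') - c' * (1 - pi * d)), (d + d' - pi * d * d').
    split; first by rewrite !(rpredB, rpredM, rpred1).
      by rewrite !(rpredB, rpredD, rpredM).
    rewrite -[X in _ = _ / X](_ : (1 - pi * d) * (1 - pi * d') = _).
      by field; rewrite !nz.
    by ring.
  - move=> _ _ [c [d [Wc Wd ->]]] [c' [d' [Wc' Wd' ->]]].
    exists (c * c'), (d + d' - pi * d * d').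
    split; first by rewrite rpredM.
      by rewrite !(rpredB, rpredD, rpredM).
    rewrite -[X in _ = _ / X](_ : (1 - pi * d) * (1 - pi * d') = _).
      by field; rewrite !nz.
    by ring.
  - exists (1 - pi * a)^-1; last by move/WP.
    by exists 1, a; rewrite rpred1 mul1r.
  move=> e; have {}e : pi^-1 * (1 - pi * d) = c by rewrite e divfK ?nz.
  apply/Ap/WP.
  suff ->: pi^-1 = c + d by rewrite rpredD.
  by rewrite -e mulrBr mulr1 mulKf // subrK.
move=> x; have [->|x0] := eqVneq x 0; first by left; rewrite rpred0.
apply: boolp.contrapT => /boolp.not_orP [nx nxV].
have ext y : y \notin W -> exists2 g, g \is a polyOver W & pi * g.[y] = 1.
  move=> nWy.
  have [|||||g Wg e] // := Amax (fun x => exists2 g, g \is a polyOver W & x = g.[y]).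
  - by move=> a /WP Wa; exists a%:P; rewrite ?polyOverC ?hornerC.
  - by exists 1; rewrite ?rpred1 ?hornerE.
  - by move=> _ _ [g Wg ->] [h Wh ->]; exists (g - h); rewrite ?rpredB ?hornerE.
  - by move=> _ _ [g Wg ->] [h Wh ->]; exists (g * h); rewrite ?rpredM ?hornerE.
  - by exists y; [exists 'X; rewrite ?polyOverX ?hornerX | move/WP; apply/negP].
  by exists g; rewrite // -e divff.
have [g Wg gx] := ext x (introN idP nx); have [h Wh hx] := ext _ (introN idP nxV).
exact: (inv_integral_exchange Wpi unit1 (divff x0) Wg Wh gx hx).
Qed.

(** * Contents of polynomials over a valuation ring *)

Section Content.
Variables (K : fieldType) (V : subringClosed K).
Hypothesis Vval : forall x, x \in V \/ x^-1 \in V.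

(** The maximal ideal of [V]: when x^-1 is outside [V], x is inside by the valuation property. Zero
    is listed apart because its inverse is 0 by convention. *)
Definition maxid : {pred K} := fun x => (x == 0) || (x^-1 \notin V).

Lemma maxidE x : (x \in maxid) = (x == 0) || (x^-1 \notin V).
Proof. by []. Qed.

Lemma maxid0 : 0 \in maxid. Proof. by rewrite maxidE eqxx. Qed.

Lemma maxid1 : 1 \notin maxid.
Proof. by rewrite maxidE invr1 rpred1 oner_eq0. Qed.

Lemma maxidPn x : reflect (x != 0 /\ x^-1 \in V) (x \notin maxid).
Proof. by rewrite maxidE negb_or negbK; apply: andP. Qed.

Lemma maxidV x : x \in maxid -> x \in V.
Proof.
rewrite maxidE; case/orP=> [/eqP->|]; first exact: rpred0.
by case: (Vval x) => // ->.
Qed.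

Lemma notin_maxid x : x \notin V -> x != 0 /\ x^-1 \in maxid.
Proof.
move=> nVx; split; first by apply: contraNneq nVx => ->; rewrite rpred0.
by rewrite maxidE invrK nVx orbT.
Qed.

Lemma maxidM a x : a \in V -> x \in maxid -> a * x \in maxid.
Proof.
move=> Va; apply: contraLR => /maxidPn[]; rewrite mulf_eq0 => /norP[a0 x0] Vi.
apply/maxidPn; split=> //.
by rewrite -[x^-1](mulKf a0) mulrCA -invfM mulrC rpredM // mulrC.
Qed.

Lemma maxidMr a x : a \in V -> x \in maxid -> x * a \in maxid.
Proof. by rewrite mulrC; apply: maxidM. Qed.

Lemma maxid_prime x y : x \notin maxid -> y \notin maxid -> x * y \notin maxid.
Proof.
move=> /maxidPn[x0 Vx] /maxidPn[y0 Vy]; apply/maxidPn.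
by rewrite mulf_neq0 // invfM rpredM.
Qed.

Lemma maxid_exp x n : x \notin maxid -> x ^+ n \notin maxid.
Proof.
move=> mx; elim: n => [|n IHn]; first exact: maxid1.
by rewrite exprS maxid_prime.
Qed.

Lemma maxidD x y : x \in maxid -> y \in maxid -> x + y \in maxid.
Proof.
move=> mx my; have [->|x0] := eqVneq x 0; first by rewrite add0r.
have [->|y0] := eqVneq y 0; first by rewrite addr0.
case: (Vval (x / y)) => [Vxy|].
  by rewrite -[x](divfK y0) -{3}[y]mul1r -mulrDl maxidM // rpredD ?rpred1.
rewrite invf_div => Vyx.
by rewrite -[y](divfK x0) -{1}[x]mul1r -mulrDl maxidM // rpredD ?rpred1.
Qed.

Lemma maxidN x : (- x \in maxid) = (x \in maxid).
Proof. by rewrite !maxidE oppr_eq0 invrN rpredN. Qed.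

Lemma maxidDr x y : x \in maxid -> (x + y \in maxid) = (y \in maxid).
Proof.
move=> mx; apply/idP/idP => [mxy|]; last exact: maxidD.
by rewrite -[y](addKr x) maxidD // maxidN.
Qed.

Lemma maxid_sum (J : Type) (r : seq J) (Q : pred J) (F : J -> K) :
  (forall j, Q j -> F j \in maxid) -> \sum_(j <- r | Q j) F j \in maxid.
Proof.
move=> mF; elim/big_ind: _ => //; [exact: maxid0 | exact: maxidD].
Qed.

Definition primitive (P : {poly K}) :=
  P \is a polyOver V /\ exists i, P`_i \notin maxid.

(** Gauss's lemma: if i and j are the first indices of unit coefficients, then the coefficient of
    index i + j of the product is a unit modulo the maximal ideal. *)
Lemma primitiveM P Q : primitive P -> primitive Q -> primitive (P * Q).
Proof.
move=> [VP exP] [VQ exQ]; split; first exact: rpredM.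
have [i Pi minP] := ex_minnP exP; have [j Qj minQ] := ex_minnP exQ.
exists (i + j)%N; rewrite coefM.
have lti : (i < (i + j).+1)%N by rewrite ltnS leq_addr.
rewrite (bigD1 (Ordinal lti)) //= addKn addrC maxidDr; first exact: maxid_prime.
apply: maxid_sum => k; rewrite -val_eqE /= => ki.
case: (ltngtP k i) ki => // [lt_ki|lt_ik] _.
  apply: maxidMr; first exact/polyOverP.
  by apply: contraLR lt_ki => /minP; rewrite -leqNgt.
apply: maxidM; first exact/polyOverP.
have : (i + j - k < j)%N by have := ltn_ord k; lia.
by apply: contraLR => /minQ; rewrite -leqNgt.
Qed.

(** A relation and not a function: c stands for an element of the value group and is determined only
    up to a unit of [V]. *)
Definition is_content (c : K) (P : {poly K}) := c != 0 /\ primitive (c^-1 *: P).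

Lemma content_neq0 c P : is_content c P -> P != 0.
Proof.
case=> _ [_ [i]]; apply: contraNneq => ->.
by rewrite scaler0 coef0 maxid0.
Qed.

Lemma contentM c d P Q :
  is_content c P -> is_content d Q -> is_content (c * d) (P * Q).
Proof.
move=> [c0 pP] [d0 pQ]; split; first exact: mulf_neq0.
by rewrite invfM -scalerA scalerAr scalerAl; apply: primitiveM.
Qed.

Lemma primitive_const c : c \in V -> c \notin maxid -> primitive c%:P.
Proof.
move=> Vc mc; split; first by rewrite polyOverC.
by exists 0%N; rewrite coefC.
Qed.

Lemma content_const c : c != 0 -> is_content c c%:P.
Proof.
move=> c0; split=> //; rewrite -mul_polyC -polyCM mulVf //.
by apply: primitive_const; rewrite ?rpred1 ?maxid1.
Qed.

Lemma content_prod (J : eqType) (r : seq J) (c : J -> K) (P : J -> {poly K}) :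
    (forall j, j \in r -> is_content (c j) (P j)) ->
  is_content (\prod_(j <- r) c j) (\prod_(j <- r) P j).
Proof.
elim: r => [|j r IHr] cP; first by rewrite !big_nil; apply/content_const/oner_neq0.
rewrite !big_cons; apply: contentM; first by apply: cP; rewrite mem_head.
by apply: IHr => i ri; apply: cP; rewrite inE ri orbT.
Qed.

(** Used in both orders, this makes the quotient of two contents of the same polynomial a unit. *)
Lemma content_div c d P : is_content c P -> is_content d P -> c / d \in V.
Proof.
move=> [c0 [_ [i mi]]] [d0 [VQ _]].
have /maxidPn[Pi0 Vi] := mi; rewrite coefZ in Pi0 Vi.
have := polyOverP VQ i; rewrite coefZ => Vdi.
have [Pi0' _] : P`_i != 0 /\ true by split=> //; apply: contraNneq Pi0 => ->; rewrite mulr0.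
have -> : c / d = d^-1 * P`_i * (c^-1 * P`_i)^-1.
  by field; rewrite c0 d0 Pi0'.
exact: rpredM.
Qed.

(** An entry of largest absolute value, by which a family is normalised. *)
Lemma max_in_family (n : nat) (F : 'I_n -> K) : (exists i, F i != 0) ->
  exists2 i, F i != 0 & forall j, F j / F i \in V.
Proof.
elim: n F => [|n IHn] F [i0 Fi0]; first by case: i0 Fi0.
have [[j Fj]|F0] := boolp.pselect (exists j : 'I_n, F (lift ord0 j) != 0).
  have [i Fi maxi] := IHn (fun j => F (lift ord0 j)) (ex_intro _ j Fj).
  have [F00|F00] := eqVneq (F ord0) 0.
    exists (lift ord0 i) => // k; case: (unliftP ord0 k) => [k' ->|->] //.
    by rewrite F00 mul0r rpred0.
  case: (Vval (F ord0 / F (lift ord0 i))) => [V0|].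
    by exists (lift ord0 i) => // k; case: (unliftP ord0 k) => [k' ->|->].
  rewrite invf_div => V0; exists ord0 => // k.
  case: (unliftP ord0 k) => [k' ->|->]; last by rewrite divff // rpred1.
  have := rpredM (maxi k') V0.
  by rewrite /= mulrA divfK.
have F0' j : F (lift ord0 j) = 0.
  by apply: boolp.contrapT => /eqP h; apply: F0; exists j.
have F00 : F ord0 != 0.
  by case: (unliftP ord0 i0) Fi0 => [j ->|->] //; rewrite F0' eqxx.
exists ord0 => // j; case: (unliftP ord0 j) => [k ->|->].
  by rewrite F0' mul0r rpred0.
by rewrite divff // rpred1.
Qed.

End Content.

(** * Reduction modulo p *)

Section Reduction.
Variables (p : nat) (V : subringClosed algC).
Hypothesis p_pr : prime p.
Hypothesis Vval : forall x, x \in V \/ x^-1 \in V.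
Hypothesis Vp : p%:R^-1 \notin V.

Local Notation mV := (maxid V).
Local Notation red := (map_poly (intr : int -> 'F_p)).
Local Notation toC := (map_poly (intr : int -> algC)).

Lemma maxid_prime_nat : p%:R \in mV.
Proof. by rewrite maxidE Vp orbT. Qed.

Lemma maxid_int (z : int) : (z%:~R \in mV) = (p %| z)%Z.
Proof.
apply/idP/idP => [mz|/dvdzP[k ->]]; last first.
  by rewrite rmorphM maxidM ?rpred_int ?maxid_prime_nat.
apply: contraT => pz; have /coprimezP[[u v] /= uv1] : coprimez z p.
  by rewrite coprimez_sym /coprimez /gcdz absz_nat -[_ == _]/(coprime p `|z|%N) prime_coprime.
have := maxid1 V; rewrite -[1]/(1%:~R) -uv1 rmorphD !rmorphM.
rewrite maxidD // maxidM ?rpred_int //; exact: maxid_prime_nat.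
Qed.

Lemma Fp_intr_eq0 (z : int) : (z%:~R == 0 :> 'F_p) = (p %| z)%Z.
Proof.
by rewrite {1}[z]intEsign rmorphM rmorph_sign mulf_eq0 signr_eq0 /= -(dvdn_pcharf (pchar_Fp p_pr)).
Qed.

Lemma red_lift (q : {poly 'F_p}) : exists g : {poly int}, red g = q.
Proof.
exists (\poly_(i < size q) ((q`_i)%R : nat)%:Z); apply/polyP => i.
rewrite coef_map coef_poly; case: ltnP => [_|le]; last by rewrite nth_default.
by rewrite /= -pmulrn natr_Zp.
Qed.

Lemma red_eq0 (g : {poly int}) : red g = 0 -> exists C : {poly int}, g = p%:Z *: C.
Proof.
move=> g0; exists (\poly_(i < size g) (g`_i %/ p)%Z); apply/polyP => i.
rewrite coefZ coef_poly; case: ltnP => [_|le]; last by rewrite nth_default ?mulr0.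
apply/eqP; rewrite mulrC eq_sym -dvdz_eq -Fp_intr_eq0.
by have /polyP/(_ i) := g0; rewrite coef_map coef0 => ->.
Qed.

Lemma toC_in (g : {poly int}) x : x \in V -> (toC g).[x] \in V.
Proof.
by move=> Vx; apply: rpred_horner => //; apply/polyOverP => i; rewrite coef_map rpred_int.
Qed.

(** A Bezout relation modulo p lifts to A g + B h = 1 + p C over the integers; if g(x) and h(x) were
    both in the maximal ideal, so would be 1. *)
Lemma coprime_red_eval (g h : {poly int}) x : x \in V ->
    coprimep (red g) (red h) ->
  (toC g).[x] \in mV -> (toC h).[x] \notin mV.
Proof.
move=> Vx /Bezout_eq1_coprimepP[[u v] /= uv1] mg.
have [A uA] := red_lift u; have [B vB] := red_lift v.
have [|C eC] := @red_eq0 (A * g + B * h - 1).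
  by rewrite rmorphB rmorphD !rmorphM rmorph1 /= uA vB uv1 subrr.
apply/negP => mh; have := maxid1 V; apply/negP; rewrite negbK.
have /(congr1 (fun q => (toC q).[x])) := eC.
rewrite rmorphB rmorphD !rmorphM rmorph1 map_polyZ !hornerE => e.
have -> : 1 = (toC A).[x] * (toC g).[x] + (toC B).[x] * (toC h).[x]
              - (toC C).[x] * p%:R :> algC.
  by rewrite [X in _ - X]mulrC -e opprB addrC subrK.
by rewrite !maxidD ?maxidN // maxidM ?toC_in // maxid_prime_nat.
Qed.

(** * Roots of an integer polynomial that is irreducible modulo p *)

Section Root.
Variable f : {poly int}.
Hypothesis lead_f : ~~ (p %| lead_coef f)%Z.
Hypothesis irr_f : irreducible_poly (red f).

Lemma size_red : size (red f) = size f.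
Proof. by rewrite size_poly_eq // Fp_intr_eq0. Qed.

(** If x^-1 were in the maximal ideal, dividing f(x) = 0 by the top power of x would put the leading
    coefficient there, against [lead_f]. *)
Lemma root_integral x : root (toC f) x -> x \in V.
Proof.
move=> fx; apply: contraT => /(notin_maxid) [x0 mx].
have szf : size f = (size f).-1.+1.
  by rewrite prednK // lt0n size_poly_eq0; apply: contraNneq lead_f => ->; rewrite lead_coef0.
have : (lead_coef f)%:~R \in mV; last by rewrite maxid_int (negPf lead_f).
have : \sum_(i < size f) (f`_i)%:~R * x ^+ i * x ^- (size f).-1 = 0 :> algC.
  rewrite -mulr_suml; move/rootP: fx; rewrite horner_coef size_map_poly_id0; last first.
    by rewrite intr_eq0 lead_coef_eq0 -size_poly_eq0 szf.
  by under eq_bigr do rewrite coef_map; move=> ->; rewrite mul0r.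
rewrite szf big_ord_recr /= -lead_coefE mulfK ?expf_neq0 // => /eqP.
rewrite addrC addr_eq0 => /eqP ->; rewrite maxidN.
apply: maxid_sum => // i _; rewrite -mulrA maxidM ?rpred_int //.
have -> : x ^+ i * x ^- (size f).-1 = x^-1 ^+ ((size f).-1 - i.+1) * x^-1.
  by rewrite -exprSr subnSK // exprVn expfB // invf_div.
by rewrite maxidM // rpredX // maxidV.
Qed.

(** Being of smaller degree and nonzero modulo p, q is coprime to f modulo p. In other words, the
    powers of x below deg f are independent over F_p in the residue field. *)
Lemma eval_unit (q : {poly int}) x : root (toC f) x -> red q != 0 ->
  (size q < size f)%N -> (toC q).[x] \notin mV.
Proof.
move=> fx q0 ltqf; apply: (coprime_red_eval (g := f)) (root_integral fx) _ _.
  rewrite irreducible_poly_coprime //; apply: contraTN ltqf => /(dvdp_leq q0).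
  by rewrite size_red -leqNgt => /leq_trans-> //; apply: size_poly.
by rewrite (rootP fx) maxid0.
Qed.

Lemma int_multiple_primitive (r : {poly rat}) : (size r < size f)%N ->
  exists (c : rat) (q : {poly int}),
    [/\ r = c *: map_poly intr q, red q != 0 & (size q < size f)%N].
Proof.
move=> ltrf; have [->|r0] := eqVneq r 0.
  exists 0, 1; rewrite scale0r rmorph1 oner_eq0 size_poly1; split=> //.
  by case: irr_f; rewrite size_red.
have [q [a a0 ra]] := rat_poly_scale r.
have q0 : q != 0 by apply: contraNneq r0 => q0; rewrite ra q0 rmorph0 scaler0.
exists (a%:~R^-1 * (zcontents q)%:~R), (zprimitive q); split.
- by rewrite -scalerA -map_polyZ -zpolyEprim.
- apply: contra_neq (q0) => /red_eq0[C eC].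
  have := zcontents_primitive q; rewrite q0 eC zcontentsZ => h.
  have : (p %| 1%:Z)%Z by rewrite -[1%:Z]/(true : nat)%:Z -h dvdz_mulr.
  by rewrite dvdz1 absz_nat => /eqP p1; move: p_pr; rewrite p1.
- rewrite size_zprimitive; apply: leq_ltn_trans ltrf.
  rewrite ra size_scale ?invr_eq0 ?intr_eq0 // size_map_poly_id0 //.
  by rewrite intr_eq0 lead_coef_eq0.
Qed.

(** A proper factor is a scalar times an integer polynomial nonzero modulo p; at a common root with
    f the latter would be both zero and a unit. *)
Lemma irreducible_rat : irreducible_poly (map_poly intr f : {poly rat}).
Proof.
have szf : size (map_poly intr f : {poly rat}) = size f.
  rewrite size_map_poly_id0 // intr_eq0; apply: contraNneq lead_f => ->.
  exact: dvdz0.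
split=> [|q szq dvq]; first by rewrite szf -size_red; case: irr_f.
rewrite -dvdp_size_eqp // szf eqn_leq -{1}szf dvdp_leq -?size_poly_eq0 ?szf //=; last first.
  by rewrite -size_red -lt0n ltnW //; case: irr_f.
rewrite leqNgt; apply/negP => ltqf.
have [c [r [qr r0 szr]]] := int_multiple_primitive ltqf.
have sz : size (map_poly ratr q : {poly algC}) != 1%N by rewrite size_map_poly.
have [x qx] := closed_rootP _ sz.
have fx : root (toC f) x.
  have -> : toC f = map_poly ratr (map_poly intr f : {poly rat}).
    by rewrite -map_poly_comp; apply: eq_map_poly => z /=; rewrite ratr_int.
  by have /dvdpP[s ->] := dvq; rewrite rmorphM rootM qx orbT.
have c0 : c != 0.
  apply: contraTneq szq => c0; move: qr; rewrite c0 scale0r => q0.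
  move: dvq; rewrite q0 dvd0p -size_poly_eq0 szf -size_red => /eqP sz0.
  by case: irr_f; rewrite sz0.
have := eval_unit fx r0 szr; rewrite (_ : (toC r).[x] = 0) ?maxid0 //.
move/rootP: qx; rewrite qr map_polyZ hornerZ -map_poly_comp.
rewrite (eq_map_poly (g := intr)) => [/eqP|z /=]; last by rewrite ratr_int.
by rewrite mulf_eq0 fmorph_eq0 (negPf c0) => /eqP.
Qed.

(* D is a polynomial in T whose coefficients are polynomials in S; the point is
   that the content of D(theta, T) does not depend on the root theta. *)
Lemma content_at_root (D : {poly {poly rat}}) : exists c : rat, forall x,
    root (toC f) x ->
    map_poly (horner_eval x \o map_poly ratr) D != 0 ->
  is_content V (ratr c) (map_poly (horner_eval x \o map_poly ratr) D).
Proof.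
pose f' : {poly rat} := map_poly intr f.
have szf' : size f' = size f.
  rewrite size_map_poly_id0 // intr_eq0; apply: contraNneq lead_f => ->.
  exact: dvdz0.
have f'0 : f' != 0.
  by rewrite -size_poly_eq0 szf' -size_red -lt0n ltnW //; case: irr_f.
(* Each coefficient of D is reduced modulo f and split into a rational scalar and an integer
   polynomial whose value at every root is a unit; only the scalar affects the absolute value. *)
have /boolp.choice[cq cqE] (j : nat) : exists cq : rat * {poly int},
    [/\ D`_j %% f' = cq.1 *: map_poly intr cq.2, red cq.2 != 0
      & (size cq.2 < size f)%N].
  have [|c [q h]] := @int_multiple_primitive (D`_j %% f'); last by exists (c, q).
  by rewrite -szf' ltn_modp.
have coefD x j : root (toC f) x ->
    (map_poly ratr D`_j).[x] = ratr (cq j).1 * (toC (cq j).2).[x].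
  move=> fx; have [e _ _] := cqE j.
  rewrite {1}(divp_eq D`_j f') rmorphD rmorphM /= hornerD hornerM.
  rewrite -[map_poly ratr f']map_poly_comp (eq_map_poly (g := intr)) => [|z /=]; last first.
    by rewrite ratr_int.
  rewrite (rootP fx) mulr0 add0r e map_polyZ hornerZ -map_poly_comp.
  by rewrite (eq_map_poly (g := intr)) // => z /=; rewrite ratr_int.
have [[i ci]|c0] := boolp.pselect (exists i : 'I_(size D), (cq i).1 != 0); last first.
  exists 0 => x fx; case/negP; apply/eqP/polyP => j; rewrite coef0.
  have [ltj|lej] := ltnP j (size D); last first.
    by rewrite coef_map_id0 ?nth_default //= rmorph0 /horner_eval horner0.
  rewrite coef_map_id0 /= ?rmorph0 /horner_eval ?horner0 // coefD //.
  suff -> : (cq j).1 = 0 by rewrite rmorph0 mul0r.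
  by apply: boolp.contrapT => /eqP h; apply: c0; exists (Ordinal ltj).
(* The content is the largest of the scalars, which do not involve the root. *)
have [|k ck maxk] := max_in_family Vval (F := fun i : 'I_(size D) => ratr (cq i).1).
  by exists i; rewrite fmorph_eq0.
exists (cq k).1 => x fx _; split=> //.
have cf j : (map_poly (horner_eval x \o map_poly ratr) D)`_j
          = ratr (cq j).1 * (toC (cq j).2).[x].
  by rewrite coef_map_id0 /= ?rmorph0 /horner_eval ?horner0 // coefD.
split; last first.
  exists k; rewrite coefZ cf mulKf //.
  by have [_ ? ?] := cqE k; apply: eval_unit.
apply/polyOverP => j; rewrite coefZ.
have [ltj|lej] := ltnP j (size D); last first.
  by rewrite [_`_j]nth_default ?mulr0 ?rpred0 // (leq_trans (size_poly _ _)).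
rewrite cf mulrA; apply: rpredM; last by rewrite toC_in // root_integral.
by rewrite mulrC; exact: (maxk (Ordinal ltj)).
Qed.

End Root.

(** * The p-adic valuation of rational numbers *)

Lemma rat_padic (q : rat) : q != 0 -> exists (i j : nat) (u : algC),
  [/\ ratr q * p%:R ^+ j = p%:R ^+ i * u, u \in V, u^-1 \in V & u != 0].
Proof.
move=> q0.
have natV (a : nat) : (0 < a)%N -> exists (i : nat) (u : algC),
    [/\ a%:R = p%:R ^+ i * u, u \in V, u^-1 \in V & u != 0].
  move=> a0; have [b cb ab] := pfactor_coprime p_pr a0.
  have /maxidPn[b0 Vb] : b%:R \notin mV.
    by rewrite pmulrn maxid_int -prime_coprime.
  exists (logn p a), b%:R; split=> //; last exact: rpred_nat.
  by rewrite {1}ab natrM natrX mulrC.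
have [|i [u [ei Vu Vu' u0]]] := natV `|numq q|%N; first by rewrite absz_gt0 numq_eq0.
have [|j [v [ej Vv Vv' v0]]] := natV `|denq q|%N; first by rewrite absz_gt0 denq_eq0.
exists i, j, ((-1) ^+ (numq q < 0)%R * u / v).
have p0 : p%:R != 0 :> algC by rewrite pnatr_eq0 -lt0n prime_gt0.
split; rewrite ?rpredM ?rpredX ?rpredN ?rpred1 //.
- rewrite /ratr {1}[numq q]intEsign -[denq q]gtz0_abs ?denq_gt0 //.
  rewrite rmorphM rmorph_sign /= -!pmulrn ei ej.
  move: (p%:R ^+ i) (p%:R ^+ j) (expf_neq0 j p0) ((-1) ^+ _) => P Q Q0 s.
  by field; rewrite v0 Q0.
- by rewrite !invfM invrK invr_sign !rpredM ?rpredX ?rpredN ?rpred1.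
- by rewrite !mulf_neq0 ?signr_eq0 ?invr_eq0.
Qed.

(** A unit has valuation 0, so n + m v(q) = 0, where the integer v(q) is the difference i - j given
    by [rat_padic]. *)
Lemma dvd_of_power_ratio (n m : nat) (q : rat) : q != 0 ->
    p%:R ^+ n * ratr q ^+ m \in V -> (p%:R ^+ n * ratr q ^+ m)^-1 \in V ->
  (m %| n)%N.
Proof.
move=> q0; set w := _ * _ => Vw Vw'.
have p0 : p%:R != 0 :> algC by rewrite pnatr_eq0 -lt0n prime_gt0.
have w0 : w != 0 by rewrite mulf_neq0 ?expf_neq0 // fmorph_eq0.
have [i [j [u [eq Vu Vu' u0]]]] := rat_padic q0.
have e : w * p%:R ^+ (j * m) = p%:R ^+ (n + i * m) * u ^+ m.
  by rewrite /w -mulrA !exprM -exprMn eq exprMn -exprM mulrA -exprD.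
have unit_pow a b x : x \in V -> x^-1 \in V -> x != 0 ->
    p%:R ^+ a = p%:R ^+ b * x -> (b <= a)%N.
  move=> Vx Vx' x0 e'; rewrite leqNgt; apply/negP => lt.
  have : 1 \in mV; last by rewrite (negPf (maxid1 V)).
  suff -> : 1 = p%:R ^+ (b - a).-1 * x * p%:R :> algC.
    by rewrite maxidM ?maxid_prime_nat // rpredM // rpredX // rpred_nat.
  apply: (mulfI (expf_neq0 a p0)); rewrite mulr1 {1}e'.
  rewrite mulrAC -exprSr prednK ?subn_gt0 // mulrA -exprD.
  by rewrite subnKC // ltnW.
clearbody w; set z := w / u ^+ m.
have um0 : u ^+ m != 0 by rewrite expf_neq0.
have Vz : z \in V by rewrite /z -exprVn rpredM // rpredX.
have Vz' : z^-1 \in V by rewrite /z invfM invrK rpredM // rpredX.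
have z0 : z != 0 by rewrite mulf_neq0 // invr_eq0.
have {}e : z * p%:R ^+ (j * m) = p%:R ^+ (n + i * m).
  by rewrite /z mulrAC e mulfK.
have eq_ij : (j * m = n + i * m)%N.
  apply/eqP; rewrite eqn_leq; apply/andP; split.
    by apply: (unit_pow _ _ z) => //; rewrite mulrC e.
  apply: (unit_pow _ _ z^-1) => //; rewrite ?invrK ?invr_eq0 //.
  by rewrite -e mulrC mulKf.
by rewrite -(dvdn_addl n (dvdn_mull i (dvdnn m))) -eq_ij dvdn_mull.
Qed.
End Reduction.

(** * Norms as symmetric functions of the conjugates *)

(** The product is symmetric in the roots, hence a polynomial in the coefficients of mu. The element
    r is chosen before [phi], so one r serves all specialisations. *)
Lemma prod_roots_rational (R : comNzRingType) (n : nat) (mu G : {poly R}) :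
  exists r : R, forall (S : idomainType) (phi : {rmorphism R -> S}) (a : n.-tuple S),
    map_poly phi mu = \prod_(c <- a) ('X - c%:P) ->
  phi r = \prod_(c <- a) (map_poly phi G).[c].
Proof.
pose Q : {mpoly R[n]} := \prod_(i < n) (map_poly (@mpolyC n R) G).['X_i].
have symQ : Q \is symmetric.
  apply/issymP => s; rewrite /Q rmorph_prod /=.
  rewrite [RHS](reindex_inj (@perm_inj _ s)) /=.
  apply: eq_bigr => i _; rewrite -!horner_map -!map_poly_comp /=.
  rewrite (eq_map_poly (g := @mpolyC n R)) => [|c]; last first.
    by rewrite /= -[c%:MP]mulr1 mul_mpolyC msymZ msym1.
  by congr (_.[_]); rewrite msymX; congr 'X_[_]; apply/mnmP => j; rewrite !mnmE -(inj_eq (@perm_inj _ s)) permKV.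
have [t [Qt _]] := sym_fundamental symQ.
(* Variable i of [t] stands for the elementary symmetric function of degree i + 1, which is this
   signed coefficient of mu. *)
exists (t.@[fun i => (-1) ^+ i.+1 * mu`_(n - i.+1)]) => S phi a muE.
pose psi : {rmorphism {mpoly R[n]} -> S} := mmap phi (tnth a).
have psiC c : psi c%:MP = phi c by rewrite /psi /= mmapC.
have psiX i : psi 'X_i = tnth a i by rewrite /psi /= mmapX mmap1U.
have -> : \prod_(c <- a) (map_poly phi G).[c] = psi Q.
  rewrite big_tuple rmorph_prod; apply: eq_bigr => i _.
  rewrite -horner_map -map_poly_comp psiX.
  by congr (_.[_]); apply: eq_map_poly => c; rewrite /= psiC.
rewrite -Qt mevalE comp_mpolyE !rmorph_sum.
apply: eq_bigr => m _; rewrite -mul_mpolyC !rmorphM psiC !rmorph_prod.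
congr (_ * _); apply: eq_bigr => i _; rewrite !rmorphXn; congr (_ ^+ _).
rewrite tnth_mktuple rmorphM rmorphXn rmorphN1 -coef_map muE.
have lti : (i.+1 < n.+1)%N by rewrite ltnS.
rewrite (mroots_coeff a (Ordinal lti)) mulrA -exprMn mulrNN mulr1 expr1n mul1r.
rewrite /mesym !rmorph_sum; apply: eq_bigr => h _.
by rewrite !rmorph_prod; apply: eq_bigr => j _; rewrite /= mevalXU psiX.
Qed.

(** * Binary forms *)

(** The homogenisation y^m g(x/y) of g in degree m. *)
Definition hform (R : comNzRingType) (m : nat) (g : {poly R}) (x y : R) : R :=
  \sum_(i < m.+1) g`_i * x ^+ i * y ^+ (m - i).

Section BinaryForm.
Variable R : comNzRingType.
Implicit Types (g : {poly R}) (x y c h : R).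

Lemma rmorph_hform (S : comNzRingType) (phi : {rmorphism R -> S}) m g x y :
  phi (hform m g x y) = hform m (map_poly phi g) (phi x) (phi y).
Proof.
rewrite /hform rmorph_sum; apply: eq_bigr => i _.
by rewrite !rmorphM !rmorphXn coef_map.
Qed.

Lemma hform_scale m g c x y : hform m g (c * x) (c * y) = c ^+ m * hform m g x y.
Proof.
rewrite /hform mulr_sumr; apply: eq_bigr => i _.
have im : (i <= m)%N by rewrite -ltnS.
have -> : c ^+ m = c ^+ i * c ^+ (m - i) by rewrite -exprD subnKC.
by rewrite !exprMn; ring.
Qed.

Lemma hformZ m a g x y : hform m (a *: g) x y = a * hform m g x y.
Proof.
by rewrite /hform mulr_sumr; apply: eq_bigr => i _; rewrite coefZ !mulrA.
Qed.

Lemma hform_XsubC m g c x y : (size g <= m.+1)%N ->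
  hform m.+1 (('X - c%:P) * g) x y = (x - c * y) * hform m g x y.
Proof.
move=> szg; rewrite /hform [RHS]mulrBl.
under eq_bigr do rewrite mulrBl coefB coefXM coefCM 2!mulrBl.
rewrite sumrB; congr (_ - _).
  rewrite big_ord_recl /= !mul0r add0r mulr_sumr; apply: eq_bigr => i _.
  by rewrite /= exprS subSS; ring.
rewrite big_ord_recr /= nth_default // mulr0 !mul0r addr0 mulr_sumr.
by apply: eq_bigr => i _; rewrite subSn -1?ltnS // exprS; ring.
Qed.

Lemma hform_prod (s : seq R) x y :
  hform (size s) (\prod_(c <- s) ('X - c%:P)) x y = \prod_(c <- s) (x - c * y).
Proof.
elim: s => [|c s IHs]; first by rewrite !big_nil /hform big_ord1 coefC !expr0 !mulr1.
by rewrite !big_cons /= hform_XsubC ?IHs // size_prod_XsubC.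
Qed.

(** The partial derivative of [hform] in x; the factor i removes the term in which [i.-1] is
    truncated. *)
Definition hform_dx m g x y : R :=
  \sum_(i < m.+1) g`_i * (x ^+ i.-1 *+ i) * y ^+ (m - i).

Lemma exprD_taylor (W : subringClosed R) x h i : x \in W -> h \in W ->
  exists2 e, e \in W & (x + h) ^+ i = x ^+ i + (x ^+ i.-1 *+ i) * h + h ^+ 2 * e.
Proof.
move=> Wx Wh; elim: i => [|i [e We eq]].
  by exists 0; rewrite ?rpred0 // !expr0 mulr0n mul0r mulr0 !addr0.
exists ((x + h) * e + x ^+ i.-1 *+ i).
  by rewrite rpredD ?rpredM ?rpredD ?rpredMn ?rpredX.
have xi : x * (x ^+ i.-1 *+ i) = x ^+ i *+ i.
  by case: i {eq} => [|i]; rewrite ?mulr0n ?mulr0 // mulrnAr -exprS.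
rewrite exprS eq [x ^+ i.+1]exprS /= mulrSr -xi; ring.
Qed.

(** The remainder stays in [W], so for h divisible by p the quadratic term is still divisible by p
    after one division by p. *)
Lemma hform_taylor (W : subringClosed R) m g x y h : g \is a polyOver W ->
    x \in W -> y \in W -> h \in W ->
  exists2 e, e \in W &
    hform m g (x + h) y = hform m g x y + hform_dx m g x y * h + h ^+ 2 * e.
Proof.
move=> /polyOverP Wg Wx Wy Wh.
have /boolp.choice[e eP] (i : nat) : exists e, e \in W /\
    (x + h) ^+ i = x ^+ i + (x ^+ i.-1 *+ i) * h + h ^+ 2 * e.
  by have [e] := exprD_taylor i Wx Wh; exists e.
exists (\sum_(i < m.+1) g`_i * e i * y ^+ (m - i)).
  by apply: rpred_sum => i _; rewrite !rpredM ?rpredX //; case: (eP i).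
rewrite /hform /hform_dx mulr_suml mulr_sumr -!big_split; apply: eq_bigr => i _ /=.
by have [_ ->] := eP i; ring.
Qed.

End BinaryForm.

Lemma hform_unit (F : fieldType) m (g : {poly F}) x y : (size g <= m.+1)%N -> y != 0 ->
  hform m g x y = y ^+ m * g.[x / y].
Proof.
move=> szg y0; rewrite (horner_coef_wide _ szg) mulr_sumr; apply: eq_bigr => i _.
have im : (i <= m)%N by rewrite -ltnS.
have -> : y ^+ m = y ^+ i * y ^+ (m - i) by rewrite -exprD subnKC.
rewrite exprMn exprVn; move: (y ^+ (m - i)) (y ^+ i) (expf_neq0 i y0) => Y Yi Yi0.
by field.
Qed.

Lemma hform_dx_unit (F : fieldType) m (g : {poly F}) x y :
  (size g <= m.+1)%N -> y != 0 ->
  hform_dx m g x y = y ^+ m.-1 * (g^`()).[x / y].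
Proof.
move=> szg y0.
have szd : (size g^`() <= m)%N.
  apply/leq_sizeP => j lemj; rewrite coef_deriv nth_default ?mul0rn //.
  exact: leq_trans szg _.
rewrite (horner_coef_wide _ szd) mulr_sumr /hform_dx big_ord_recl /= mulr0n mulr0 mul0r add0r.
apply: eq_bigr => i _; have bi : bump 0 i = i.+1 by [].
rewrite coef_deriv !bi exprMn exprVn.
have -> : y ^+ m.-1 = y ^+ i * y ^+ (m - i.+1).
  by rewrite -exprD; congr (_ ^+ _); have := ltn_ord i; lia.
move: (y ^+ (m - _)) (y ^+ i) (expf_neq0 i y0) => Y Yi Yi0.
rewrite add0n -(mulr_natl (x ^+ i)) -(mulr_natl g`_i.+1); move: (i.+1%:R : F) (x ^+ i) => k Xi.
by field.
Qed.

(** * The local computation *)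

(** The coordinate y sits in positive degree so that its coefficient is not disturbed by the
    constant -u in [primitive_local]. *)
Definition xi (R : comNzRingType) (x y z : R) : {poly R} :=
  z%:P + x%:P * 'X + y%:P * 'X^2.

Lemma coef_xi (R : comNzRingType) (x y z : R) i :
  (xi x y z)`_i = nth 0 [:: z; x; y] i.
Proof.
rewrite /xi !coefD coefC !coefCM coefX coefXn.
case: i => [|[|[|i]]] /=; rewrite ?mulr0 ?mulr1 ?addr0 ?add0r //.
by rewrite nth_nil.
Qed.

Section Local.
Variables (p : nat) (V : subringClosed algC) (m : nat) (f : {poly int}).
Hypothesis p_pr : prime p.
Hypothesis Vval : forall x, x \in V \/ x^-1 \in V.
Hypothesis Vp : p%:R^-1 \notin V.
Hypothesis m_gt1 : (1 < m)%N.
Hypothesis size_f : size f = m.+1.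
Hypothesis lead_f : ~~ (p %| lead_coef f)%Z.
Hypothesis irr_f : irreducible_poly (map_poly intr f : {poly 'F_p}).
Hypothesis sep_f : coprimep (map_poly intr f) ((map_poly intr f)^`() : {poly 'F_p}).

Local Notation mV := (maxid V).
Local Notation red := (map_poly (intr : int -> 'F_p)).
Local Notation toC := (map_poly (intr : int -> algC)).

Let mVp : p%:R \in mV. Proof. exact: maxid_prime_nat. Qed.
Let p0 : p%:R != 0 :> algC. Proof. by rewrite pnatr_eq0 -lt0n prime_gt0. Qed.
Let sizeC : (size (toC f) <= m.+1)%N. Proof. by rewrite -size_f size_poly. Qed.

(** With d the x-derivative of the form, the polynomial is -u + d xi modulo the maximal ideal. If y
    is a unit, x/y is a simple root modulo p, so d and the coefficient d y of degree 2 are units.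
    Otherwise x, y and d all reduce to 0 and the constant -u is a unit. *)
Lemma primitive_local (x y z u : algC) :
    x \in V -> y \in V -> z \in V -> u \in V ->
    hform m (toC f) x y = - (p%:R * u) ->
    (x \in mV -> y \in mV -> u \notin mV) ->
  primitive V (p%:R^-1 *:
    hform m (map_poly polyC (toC f)) (x%:P + p%:R *: xi x y z) y%:P).
Proof.
move=> Vx Vy Vz Vu fxy ndeg.
have subW : subring_closed (polyOver_pred V).
  split=> [|q r|q r]; rewrite -!/(_ \is a polyOver V).
  - exact: rpred1.
  - exact: rpredB.
  - exact: rpredM.
pose HW := GRing.isSubringClosed.Build {poly algC} (polyOver_pred V) subW.
pose W : subringClosed {poly algC} := HB.pack (polyOver_pred V) HW.
have WE q : (q \in W) = (q \is a polyOver V) by [].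
have Vf i : (toC f)`_i \in V by rewrite coef_map rpred_int.
have Wxi : xi x y z \in W.
  by rewrite WE /xi !(rpredD, rpredM, rpredX) ?polyOverC ?polyOverX.
have Vpn : p%:R \in V by rewrite rpred_nat.
have Wf : map_poly polyC (toC f) \is a polyOver W.
  by apply/polyOverP => i; rewrite coef_map WE polyOverC.
have Wx : x%:P \in W by rewrite WE polyOverC.
have Wy : y%:P \in W by rewrite WE polyOverC.
have Wh : p%:R *: xi x y z \in W by rewrite WE polyOverZ.
have [e We ->] := hform_taylor m Wf Wx Wy Wh.
pose d := hform_dx m (toC f) x y.
have -> : hform m (map_poly polyC (toC f)) x%:P y%:P = (- (p%:R * u))%:P.
  by rewrite -fxy rmorph_hform.
have -> : hform_dx m (map_poly polyC (toC f)) x%:P y%:P = d%:P.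
  rewrite /d /hform_dx rmorph_sum; apply: eq_bigr => i _ /=.
  by rewrite coef_map !polyCM polyCMn !rmorphXn.
pose e' := xi x y z ^+ 2 * e.
have We' : e' \is a polyOver V by rewrite -WE rpredM ?rpredX.
have -> : p%:R^-1 *: ((- (p%:R * u))%:P + d%:P * (p%:R *: xi x y z)
      + (p%:R *: xi x y z) ^+ 2 * e) = - u%:P + d *: xi x y z + p%:R *: e'.
  rewrite exprZn -scalerAl -/e'; apply/polyP => i.
  rewrite !(coefD, coefN, coefC, coefZ, coefCM).
  move: (e'`_i) ((xi x y z)`_i) (p%:R : algC) p0 => E X q q0.
  by case: (i == 0)%N; field; exact: q0.
have Vd : d \in V.
  by apply: rpred_sum => i _; rewrite !rpredM ?rpredX ?rpredMn ?rpredX.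
split; first by rewrite !rpredD ?rpredN ?polyOverC ?polyOverZ.
have coefE i : (- u%:P + d *: xi x y z + p%:R *: e')`_i
    = p%:R * e'`_i + (d * nth 0 [:: z; x; y] i - (if (i == 0)%N then u else 0)).
  by rewrite !coefD coefN coefC !coefZ coef_xi; case: (i == 0)%N; ring.
have me i : p%:R * e'`_i \in mV by rewrite maxidMr // (polyOverP We').
have lead_unit : (f`_m)%:~R \notin mV.
  by move: lead_f; rewrite lead_coefE size_f /= -(maxid_int p_pr Vval Vp).
have [my|my] := boolP (y \in mV).
  have mx : x \in mV.
    have : hform m (toC f) x y \in mV by rewrite fxy maxidN maxidMr.
    rewrite /hform big_ord_recr /= subnn expr0 mulr1 maxidDr //; last first.
      apply: maxid_sum => // i _; rewrite maxidM ?rpredM ?rpredX //.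
      by rewrite -[(m - i)%N]prednK ?subn_gt0 // exprS maxidMr ?rpredX.
    apply: contraLR => mx; rewrite coef_map maxid_prime ?maxid_exp //.
  (* Here m > 1 enters: d is a form of positive degree m - 1 in x and y. *)
  have md : d \in mV.
    apply: maxid_sum => // -[[|[|i]] lei] _ /=.
    - by rewrite mulr0n mulr0 mul0r maxid0.
    - rewrite mulr1n maxidM ?rpredM ?expr0 ?rpred1 //.
      by rewrite subn1 -[m.-1]prednK ?exprS ?maxidMr ?rpredX // -ltnS prednK // ltnW.
    - rewrite maxidMr ?rpredX // maxidM // -mulr_natr maxidMr ?rpred_nat //.
      by rewrite exprS maxidMr ?rpredX.
  exists 0%N; rewrite coefE /= maxidDr // maxidDr ?maxidMr // maxidN.
  exact: ndeg.
have /maxidPn[y0 Vy'] := my.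
exists 2%N; rewrite coefE /= subr0 maxidDr // maxid_prime //.
rewrite /d hform_dx_unit // maxid_prime ?maxid_exp // deriv_map.
apply: (coprime_red_eval p_pr Vval Vp (g := f)).
- by rewrite rpredM.
- by rewrite -deriv_map.
have -> : (toC f).[x / y] = - (p%:R * u) * y^-1 ^+ m.
  by rewrite -fxy hform_unit // mulrAC -exprMn divff // expr1n mul1r.
by rewrite mulNr maxidN -mulrA maxidMr // rpredM // rpredX.
Qed.

(** * The terms divisible by z, and the content at one point *)

Variable b : trip m -> int.
Hypothesis b_zm : ~~ (p %| b (ord0, ord0, ord_max))%Z.

(** The monomials of F divisible by z, with p already taken out of the coefficients: F is [hform] of
    its top form plus p times [zpart]. *)
Definition zpart (R : comNzRingType) (x y z : R) : R :=
  \sum_(t in M3 m | t3 t != 0%N) (b t)%:~R * x ^+ t1 t * y ^+ t2 t * z ^+ t3 t.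

Lemma zpart_scale (R : comNzRingType) (c x y z : R) :
  zpart (c * x) (c * y) (c * z) = c ^+ m * zpart x y z.
Proof.
rewrite /zpart mulr_sumr; apply: eq_bigr => t; rewrite inE => /andP[/eqP tm _].
have -> : c ^+ m = c ^+ t1 t * c ^+ t2 t * c ^+ t3 t by rewrite -!exprD tm.
by rewrite !exprMn; ring.
Qed.

(** Only the monomial z^m survives modulo the maximal ideal, and its coefficient is a unit by
    [b_zm]. *)
Lemma zpart_unit x y z : x \in mV -> y \in mV -> z \in V -> z \notin mV ->
  zpart x y z \notin mV.
Proof.
move=> mx my Vz mz.
have Vx := maxidV Vval mx; have Vy := maxidV Vval my.
pose t0 : trip m := (ord0, ord0, ord_max).
rewrite /zpart (bigD1 t0) /=; last first.
  by rewrite inE /t1 /t2 /t3 /= add0n add0n eqxx /= -lt0n ltnW.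
rewrite addrC maxidDr //.
  rewrite /t1 /t2 /t3 /= !expr0 !mulr1 maxid_prime ?maxid_exp //.
  by rewrite (maxid_int p_pr Vval Vp).
apply: maxid_sum => // t /andP[/andP[]]; rewrite inE => /eqP tm _ tt0.
have [e1|] := posnP (t1 t); last first.
  case: (t1 t) => // i _; rewrite exprS.
  apply: maxidMr; first by rewrite rpredX.
  apply: maxidMr; first by rewrite rpredX.
  by apply: maxidM; rewrite ?rpred_int ?maxidMr ?rpredX.
have [e2|] := posnP (t2 t); last first.
  case: (t2 t) => // i _; rewrite exprS.
  apply: maxidMr; first by rewrite rpredX.
  by apply: maxidM; rewrite ?rpredM ?rpredX ?rpred_int ?maxidMr ?rpredX.
case/negP: tt0; move: tm e1 e2; rewrite /t1 /t2 /t3 /t0.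
case: t => [[i j] k] /= tm e1 e2; apply/eqP; congr (_, _, _); apply: val_inj => //=.
by move: tm; rewrite e1 e2.
Qed.

(** Dividing by the coordinate d of largest absolute value reduces to [primitive_local]; homogeneity
    returns the factor d^m. *)
Lemma content_local (x y z : algC) : [|| x != 0, y != 0 | z != 0] ->
    hform m (toC f) x y = - (p%:R * zpart x y z) ->
  exists d, is_content V d (xi x y z) /\ is_content V (p%:R * d ^+ m)
    (hform m (map_poly polyC (toC f)) (x%:P + p%:R *: xi x y z) y%:P).
Proof.
move=> nz fxy; pose F (i : 'I_3) := nth 0 [:: z; x; y] i.
have [|k d0 maxd] := max_in_family Vval (F := F).
  by case/or3P: nz => h; [exists (@Ordinal 3 1 isT)|exists (@Ordinal 3 2 isT)
    |exists (@Ordinal 3 0 isT)].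
set d := F k in d0 maxd.
have Vz : z / d \in V := maxd (@Ordinal 3 0 isT).
have Vx : x / d \in V := maxd (@Ordinal 3 1 isT).
have Vy : y / d \in V := maxd (@Ordinal 3 2 isT).
have scaleE w : w = d * (w / d) by rewrite mulrC divfK.
have Vd : d / d \notin mV by rewrite divff // maxid1.
have xiE : xi x y z = d *: xi (x / d) (y / d) (z / d).
  apply/polyP => i; rewrite coefZ !coef_xi.
  by case: i => [|[|[|i]]] //=; rewrite ?nth_nil ?mulr0.
have Vb : zpart (x / d) (y / d) (z / d) \in V.
  by apply: rpred_sum => t _; rewrite !rpredM ?rpredX ?rpred_int.
exists d; split.
  split; rewrite // xiE scalerA mulVf // scale1r; split.
    apply/polyOverP => i; rewrite coef_xi.
    by case: i => [|[|[|i]]] //=; rewrite ?nth_nil ?rpred0.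
  exists k; rewrite coef_xi; move: Vd; rewrite {1}/d /F.
  by case: (k) => [[|[|[|i]]]].
split; first by rewrite mulf_neq0 ?expf_neq0.
have -> : p%:R *: xi x y z = d%:P * (p%:R *: xi (x / d) (y / d) (z / d)).
  by rewrite xiE mul_polyC !scalerA mulrC.
rewrite {1}[x]scaleE {2}[y]scaleE (polyCM d (x / d)) (polyCM d (y / d)) -mulrDr hform_scale.
rewrite -polyC_exp; set H := hform _ _ _ _; rewrite mul_polyC scalerA /H.
have -> : (p%:R * d ^+ m)^-1 * d ^+ m = p%:R^-1.
  by rewrite invfM divfK // expf_neq0.
apply: (primitive_local Vx Vy Vz Vb).
  apply: (mulfI (expf_neq0 m d0)); rewrite -hform_scale -!scaleE fxy.
  by rewrite mulrN mulrCA -zpart_scale -!scaleE.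
(* One normalised coordinate equals 1; when those of x and y are nonunits it must be that of z. *)
move=> mx my; apply: zpart_unit => //.
have nth_unit i : (i < 3)%N -> nth 0 [:: z; x; y] i / d \notin mV -> z / d \notin mV.
  by case: i => [|[|[|i]]] //= _; rewrite ?mx ?my.
exact: (nth_unit k (ltn_ord k) Vd).
Qed.

(** * Products over the conjugates *)

Lemma content_rat (P : {poly rat}) : P != 0 ->
  exists2 e, e != 0 & is_content V (ratr e) (map_poly ratr P).
Proof.
move=> P0; have lead0 : lead_coef P != 0 by rewrite lead_coef_eq0.
have [|k Pk maxP] := max_in_family Vval (F := fun i : 'I_(size P) => ratr P`_i).
  have lt : ((size P).-1 < size P)%N by rewrite prednK // lt0n size_poly_eq0.
  by exists (Ordinal lt); rewrite fmorph_eq0.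
exists P`_k; first by rewrite fmorph_eq0 in Pk.
split=> //; split.
  apply/polyOverP => j; rewrite coefZ coef_map /= mulrC.
  have [ltj|lej] := ltnP j (size P); first exact: (maxP (Ordinal ltj)).
  by rewrite nth_default // rmorph0 mul0r rpred0.
by exists k; rewrite coefZ coef_map mulVf // maxid1.
Qed.

Lemma horner_const_lift (R : comNzRingType) (iota : {rmorphism rat -> R})
    (phi : {rmorphism R -> {poly algC}}) (r : {poly rat}) (x : algC) :
    (forall c, phi (iota c) = (ratr c)%:P) ->
  (map_poly phi (map_poly iota r)).[x%:P] = ((map_poly ratr r).[x])%:P.
Proof.
move=> phiE; rewrite -map_poly_comp (eq_map_poly (g := polyC \o ratr)) //.
by rewrite map_poly_comp horner_map.
Qed.

(** The content of the product of the [Om c] is computed twice: point by point as p^n E^m, and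
    through the roots of f as lc^n c0^m with c0 rational. Since E is a rational e up to a unit,
    [dvd_of_power_ratio] applies to e / c0. *)
Lemma dvd_conjugates (n : nat) (a : n.-tuple algC) (mu rx ry rz : {poly rat}) :
    map_poly ratr mu = \prod_(c <- a) ('X - c%:P) ->
    (forall c, c \in a ->
       let x := (map_poly ratr rx).[c] in let y := (map_poly ratr ry).[c] in
       let z := (map_poly ratr rz).[c] in
       [|| x != 0, y != 0 | z != 0]
       /\ hform m (toC f) x y = - (p%:R * zpart x y z)) ->
  (m %| n)%N.
Proof.
move=> muE aP.
pose x c := (map_poly ratr rx).[c : algC].
pose y c := (map_poly ratr ry).[c : algC].
pose z c := (map_poly ratr rz).[c : algC].
pose Xi c := xi (x c) (y c) (z c).
pose Om c := hform m (map_poly polyC (toC f)) ((x c)%:P + p%:R *: Xi c) (y c)%:P.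
have /boolp.choice[d dP] c : exists d, c \in a ->
    is_content V d (Xi c) /\ is_content V (p%:R * d ^+ m) (Om c).
  have [ca|] := boolP (c \in a); last by exists 0.
  by have [nz e] := aP c ca; have [d ?] := content_local nz e; exists d.
have muP (R : comNzRingType) (iota : {rmorphism rat -> R})
    (phi : {rmorphism R -> {poly algC}}) : (forall c, phi (iota c) = (ratr c)%:P) ->
    map_poly phi (map_poly iota mu)
    = \prod_(c <- [tuple of map (@polyC _) a]) ('X - c%:P).
  move=> phiE; rewrite -map_poly_comp (eq_map_poly (g := polyC \o ratr)) //.
  rewrite map_poly_comp [map_poly ratr mu]muE rmorph_prod big_map /=.
  by apply: eq_bigr => c _; rewrite rmorphB /= map_polyX map_polyC.
pose E := \prod_(c <- a) d c.
have ctE : is_content V E (\prod_(c <- a) Xi c).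
  by apply: content_prod => // c /dP[].
(* The product over all conjugates has rational coefficients, so its content can be chosen
   rational. *)
have [e e0 ctXi] : exists2 e, e != 0 & is_content V (ratr e) (\prod_(c <- a) Xi c).
  pose iota : {rmorphism rat -> {poly rat}} := polyC.
  pose phi : {rmorphism {poly rat} -> {poly algC}} := map_poly ratr.
  have phiE c : phi (iota c) = (ratr c)%:P by rewrite /= map_polyC.
  pose G := map_poly iota rz + map_poly iota rx * ('X)%:P + map_poly iota ry * ('X^2)%:P.
  have [Q QP] := prod_roots_rational n (map_poly iota mu) G.
  have {QP} := QP _ phi _ (muP _ _ _ phiE); rewrite big_map => QP.
  have {}QP : phi Q = \prod_(c <- a) Xi c.
    rewrite QP; apply: eq_bigr => c _.
    rewrite /G !rmorphD !rmorphM /= !hornerE !horner_const_lift // !map_polyC /= !hornerE.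
    by rewrite map_polyX /Xi /xi expr2 mulrA.
  have Q0 : Q != 0.
    by apply: contraTneq (content_neq0 ctE) => Q0; rewrite -QP Q0 rmorph0 eqxx.
  by have [e e0] := content_rat Q0; rewrite -/(phi Q) QP; exists e.
have [D DP] : exists D : {poly {poly rat}}, forall t : algC,
    map_poly (horner_eval t \o map_poly ratr) D
    = \prod_(c <- a) ((x c)%:P + p%:R *: Xi c - t%:P * (y c)%:P).
  (* [T] is the outer variable, that of [xi]; [S] is the inner one, specialised later to a root t of
     f. *)
  pose iota : {rmorphism rat -> {poly {poly rat}}} := polyC \o polyC.
  pose T : {poly {poly rat}} := 'X.
  pose S : {poly {poly rat}} := 'X%:P.
  pose G := map_poly iota rx + p%:R * (map_poly iota rz + map_poly iota rx * T%:P
     + map_poly iota ry * (T * T)%:P) - S%:P * map_poly iota ry.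
  have [D DP] := prod_roots_rational n (map_poly iota mu) G.
  exists D => t.
  pose phi : {rmorphism {poly {poly rat}} -> {poly algC}} :=
    map_poly (horner_eval t \o map_poly ratr).
  have phiE c : phi (iota c) = (ratr c)%:P.
    by rewrite /= map_polyC /= map_polyC /horner_eval hornerC.
  have phiT : phi T = 'X by rewrite /= map_polyX.
  have phiS : phi S = t%:P by rewrite /= map_polyC /= map_polyX /horner_eval hornerX.
  have := DP _ phi _ (muP _ _ _ phiE); rewrite big_map => ->; apply: eq_bigr => c _.
  pose psi : {rmorphism {poly {poly {poly rat}}} -> {poly algC}} :=
    horner_eval c%:P \o map_poly phi.
  have psiI r : psi (map_poly iota r) = ((map_poly ratr r).[c])%:P.
    exact: horner_const_lift.
  have psiC k : psi k%:P = phi k.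
    by rewrite -[LHS]/((map_poly phi k%:P).[c%:P]) map_polyC hornerC.
  rewrite -[LHS]/(psi G) /G rmorphB [psi (_ + _)]rmorphD [psi (_ * _)]rmorphM.
  rewrite [psi p%:R]rmorph_nat !(rmorphD psi) !(rmorphM psi) !psiI !psiC.
  rewrite (rmorphM phi) phiT phiS -mul_polyC polyC_natr /Xi /xi expr2.
  by rewrite -/(x c) -/(y c) -/(z c).
have [c0 c0P] := content_at_root p_pr Vval Vp lead_f irr_f D.
have [s fs] := closed_field_poly_normal (toC f).
set lc := lead_coef _ in fs.
have lcE : lc = (lead_coef f)%:~R.
  by rewrite /lc lead_coef_map_eq // intr_eq0; apply: contraNneq lead_f => ->; apply: dvdz0.
have /maxidPn[lc0 Vlc'] : lc \notin mV by rewrite lcE (maxid_int p_pr Vval Vp).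
have Vlc : lc \in V by rewrite lcE rpred_int.
have size_s : size s = m.
  have : size (toC f) = m.+1.
    by rewrite size_map_poly_id0 ?size_f // -lcE.
  by rewrite fs size_scale // size_prod_XsubC => -[].
have OmE c : Om c = lc%:P * \prod_(t <- s) ((x c)%:P + p%:R *: Xi c - t%:P * (y c)%:P).
  rewrite /Om fs map_polyZ hformZ; congr (_ * _).
  rewrite rmorph_prod -(big_map (@polyC _) xpredT (fun t => (x c)%:P + p%:R *: Xi c - t * (y c)%:P)).
  rewrite -hform_prod size_map size_s big_map; congr (hform _ _ _ _).
  by apply: eq_bigr => t _; rewrite rmorphB /= map_polyX map_polyC.
(* Each [Om c] splits into linear factors over the roots of f; exchanging the two products collects,
   for each root t, the conjugates into D at t. *)
have prodOm : \prod_(c <- a) Om c = (lc ^+ n)%:P * \prod_(t <- s)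
    map_poly (horner_eval t \o map_poly ratr) D.
  under eq_bigr do rewrite OmE.
  rewrite big_split /= big_const_seq count_predT size_tuple iter_mulr_1 -polyC_exp.
  by rewrite exchange_big; congr (_ * _); apply: eq_bigr => t _; rewrite DP.
have ct1 : is_content V (p%:R ^+ n * E ^+ m) (\prod_(c <- a) Om c).
  have -> : p%:R ^+ n * E ^+ m = \prod_(c <- a) (p%:R * d c ^+ m).
    by rewrite big_split prodrXl big_const_seq count_predT size_tuple iter_mulr_1.
  by apply: content_prod => // c /dP[].
have root_s t : t \in s -> root (toC f) t.
  by move=> ts; rewrite fs rootZ // root_prod_XsubC.
have D0 t : t \in s -> map_poly (horner_eval t \o map_poly ratr) D != 0.
  move=> ts; apply: contraTneq (content_neq0 ct1) => Dt.
  by rewrite prodOm (big_rem t) //= Dt mul0r mulr0 eqxx.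
have ct2 : is_content V (lc ^+ n * ratr c0 ^+ m) (\prod_(c <- a) Om c).
  rewrite prodOm; apply: contentM => //; first by apply: content_const; rewrite expf_neq0.
  have -> : ratr c0 ^+ m = \prod_(t <- s) (ratr c0 : algC).
    by rewrite big_const_seq count_predT size_s iter_mulr_1.
  by apply: content_prod => // t ts; apply: c0P; rewrite ?root_s ?D0.
have [[E0 _] [e0' _]] := (ctE, ctXi).
have c00 : ratr c0 != 0 :> algC.
  by have [] := ct2; rewrite mulf_eq0 negb_or => /andP[_]; rewrite expf_eq0 (ltnW m_gt1).
have Ve := content_div ctXi ctE; have Ve' := content_div ctE ctXi.
have Vr := content_div ct1 ct2; have Vr' := content_div ct2 ct1.
have q0 : e / c0 != 0 by rewrite mulf_neq0 ?invr_eq0 // -(fmorph_eq0 (ratr : rat -> algC)).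
(* The first factor is a quotient of two contents of one polynomial, the second is built from the
   units [lc] and e / E. *)
have wE : p%:R ^+ n * ratr (e / c0) ^+ m = p%:R ^+ n * E ^+ m / (lc ^+ n * ratr c0 ^+ m)
    * (lc ^+ n * (ratr e / E) ^+ m) :> algC.
  have -> : ratr (e / c0) = ratr e / ratr c0 :> algC by rewrite fmorph_div.
  move: (ratr e : algC) (ratr c0 : algC) c00 => u v v0.
  rewrite !exprMn !exprVn; move: (expf_neq0 n lc0) (expf_neq0 m E0) (expf_neq0 m v0).
  move: (lc ^+ n) (E ^+ m) (v ^+ m) (u ^+ m) (p%:R ^+ n) => A B C F P A0 B0 C0.
  by field; rewrite A0 B0 C0.
apply: (dvd_of_power_ratio p_pr Vval Vp q0); rewrite wE.
  by rewrite rpredM // rpredM ?rpredX.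
rewrite invfM rpredM //; first by rewrite invf_div.
by rewrite invfM -!exprVn rpredM ?rpredX // invf_div.
Qed.


End Local.

(** * Primitive elements *)

(** Serves twice: over F_p to produce irreducible polynomials, and over the rationals to write the
    coordinates of a point as polynomials in one generator. *)
Lemma primitive_element_poly (F : fieldType) (L : fieldExtType F) :
    separable 1 {:L} ->
  exists (alpha : L) (mu : {poly F}),
    [/\ mu \is monic, size mu = (\dim {:L}).+1, irreducible_poly mu,
        coprimep mu mu^`()
      & (forall x, exists r : {poly F}, x = (map_poly (in_alg L) r).[alpha])
        /\ forall r : {poly F}, root (map_poly (in_alg L) r) alpha = (mu %| r)].
Proof.
move=> sepL; pose alpha := separable_generator 1 {:L}.
have full : {:L}%VS = <<1; alpha>>%VS.
  exact: eq_adjoin_separable_generator sepL (sub1v _).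
have /polyOver1P[mu muE] := minPolyOver 1%AS alpha.
have size_mu : size mu = (\dim {:L}).+1.
  rewrite -(size_map_poly (in_alg L)) -muE size_minPoly adjoin_degreeE.
  by rewrite -full dimv1 divn1.
have dvd r : root (map_poly (in_alg L) r) alpha = (mu %| r).
  rewrite -(dvdp_map (in_alg L)) -muE; apply/idP/idP => [|/dvdpP[q ->]].
    by apply: minPoly_dvdp; apply: alg_polyOver.
  by rewrite rootM root_minPoly orbT.
exists alpha, mu; split=> //.
- by rewrite -(map_monic (in_alg L)) -muE monic_minPoly.
- split=> [|q szq dvq]; first by rewrite size_mu ltnS adim_gt0.
  have := @minPoly_irr _ _ 1%AS alpha (map_poly (in_alg L) q) (alg_polyOver _ _).
  rewrite muE dvdp_map => /(_ dvq); case/orP; first by rewrite eqp_map.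
  by rewrite -(rmorph1 (map_poly (in_alg L))) eqp_map -size_poly_eq1 (negPf szq).
- have := separable_generatorP {:L} 1%AS.
  rewrite /separable_element -/alpha muE unlock deriv_map coprimep_map //.
split=> // x; have : x \in <<1; alpha>>%VS by rewrite -full memvf.
by case/Fadjoin_polyP=> _ /polyOver1P[r ->] ->; exists r.
Qed.

(** The minimal polynomial of a generator of the field with p^m elements. *)
Lemma exists_irreducible_Fp (p m : nat) : prime p -> (0 < m)%N ->
  exists mu : {poly 'F_p},
    [/\ size mu = m.+1, irreducible_poly mu & coprimep mu mu^`()].
Proof.
move=> p_pr m_gt0; have [F charF cardF] := pPrimePowerField p_pr m_gt0.
pose L : splittingFieldType 'F_p := pPrimeCharType charF.
have sepL : separable 1 {:L}.
  by have /and3P[_ ? _] := finField_galois (sub1v {:L}).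
have [_ [mu [_ szmu irr cop _]]] := primitive_element_poly sepL.
exists mu; split=> //; rewrite szmu; congr _.+1.
by rewrite (pprimeChar_dimf charF) cardF pfactorK.
Qed.

(** * Points of the curve *)

Lemma meval_intr_morphism (n : nat) (S : comNzRingType) (v : 'I_n -> S) :
  exists E : {rmorphism {mpoly int[n]} -> S},
    [/\ forall q, (map_mpoly intr q).@[v] = E q, forall c, E c%:MP = c%:~R
      & forall i, E 'X_i = v i].
Proof.
exists (meval v \o map_mpoly intr); split=> [//|c|i] /=.
  by rewrite map_mpolyC mevalC.
by rewrite map_mpolyX mevalXU.
Qed.

Section Points.
Variables (m : nat) (a : trip m -> int).

(** The restriction of F to the line z = 0, dehomogenised at y = 1. *)
Definition top_form : {poly int} :=
  \poly_(i < m.+1) a (inord i, inord (m - i), ord0).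

Lemma meval_Fform (S : comNzRingType) (v : 'I_3 -> S) :
  (map_mpoly intr (Fform a)).@[v] = \sum_(t in M3 m)
     (a t)%:~R * v 0 ^+ t1 t * v 1 ^+ t2 t * v 2%:R ^+ t3 t.
Proof.
have [E [-> EC EX]] := meval_intr_morphism v.
rewrite /Fform rmorph_sum; apply: eq_bigr => t _.
by rewrite !rmorphM !rmorphXn EC !EX.
Qed.

Lemma meval_dx_Fform (S : comNzRingType) (v : 'I_3 -> S) :
  (map_mpoly intr (mderiv 0 (Fform a))).@[v] = \sum_(t in M3 m)
     (a t)%:~R * (v 0 ^+ (t1 t).-1 *+ t1 t) * v 1 ^+ t2 t * v 2%:R ^+ t3 t.
Proof.
have [E [-> EC EX]] := meval_intr_morphism v.
rewrite /Fform linear_sum /= rmorph_sum; apply: eq_bigr => t _.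
have d_other (i : 'I_3) k : i != 0 -> mderiv 0 ('X_i ^+ k : {mpoly int[3]}) = 0.
  move=> i0; elim: k => [|k IHk]; first by rewrite expr0 mderivC.
  by rewrite exprS mderivM IHk mderivX mnm1E (negPf i0) scale0r mulr0 mul0r addr0.
have d_0 k : mderiv 0 ('X_0 ^+ k : {mpoly int[3]}) = 'X_0 ^+ k.-1 *+ k.
  elim: k => [|k IHk]; first by rewrite expr0 mderivC mulr0n.
  rewrite exprS mderivM IHk mderivX mnm1E eqxx scale1r.
  have -> : (U_(0%R) - U_(0%R) = 0 :> 'X_{1..3})%MM by apply/mnmP => i; rewrite mnmBE subnn mnm0E.
  rewrite mpolyX0 mul1r.
  case: k {IHk} => [|k]; first by rewrite mulr0n mulr0 addr0 expr0.
  by rewrite mulrnAr -exprS -mulrS.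
rewrite !mderivM (d_other 1) // (d_other 2%:R) // d_0 mderivC !mulr0 !addr0 mul0r add0r.
by rewrite !rmorphM rmorphMn !rmorphXn EC !EX.
Qed.

Lemma sum_infinity (S : zmodType) (G : nat -> nat -> int -> S) :
  \sum_(t in M3 m | t3 t == 0%N) G (t1 t) (t2 t) (a t)
  = \sum_(i < m.+1) G i (m - i)%N (a (inord i, inord (m - i), ord0)).
Proof.
pose h (i : 'I_m.+1) : trip m := (inord i, inord (m - i), ord0).
rewrite (reindex h) /=; last first.
  exists (fun t : trip m => t.1.1) => [i _|t]; first by rewrite /h /= inord_val.
  rewrite inE inE => /andP[/eqP tm /eqP t30]; rewrite /h.
  case: t tm t30 => [[i j] k]; rewrite /t1 /t2 /t3 /= => tm k0.
  congr (_, _, _); apply: val_inj; rewrite /= ?inordK //.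
    by have := ltn_ord j; lia.
  by lia.
apply: eq_big => [i|i _]; last first.
  by rewrite /t1 /t2 /= !inordK // ltnS leq_subr.
rewrite inE /t1 /t2 /t3 /= !inordK ?ltnS ?leq_subr // -1?ltnS //.
by rewrite eqxx andbT; apply/eqP; have := ltn_ord i; lia.
Qed.

Lemma sum_infinity_hform (S : comNzRingType) (x y z : S) :
  \sum_(t in M3 m | t3 t == 0%N) (a t)%:~R * x ^+ t1 t * y ^+ t2 t * z ^+ t3 t
  = hform m (map_poly intr top_form) x y.
Proof.
under eq_bigr => t /andP[_ /eqP->] do rewrite expr0 mulr1.
rewrite (sum_infinity (fun i j c => c%:~R * x ^+ i * y ^+ j)).
by apply: eq_bigr => i _; rewrite coef_map coef_poly ltn_ord.
Qed.

Lemma sum_infinity_hform_dx (S : comNzRingType) (x y z : S) :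
  \sum_(t in M3 m | t3 t == 0%N)
     (a t)%:~R * (x ^+ (t1 t).-1 *+ t1 t) * y ^+ t2 t * z ^+ t3 t
  = hform_dx m (map_poly intr top_form) x y.
Proof.
under eq_bigr => t /andP[_ /eqP->] do rewrite expr0 mulr1.
rewrite (sum_infinity (fun i j c => c%:~R * (x ^+ i.-1 *+ i) * y ^+ j)).
by apply: eq_bigr => i _; rewrite coef_map coef_poly ltn_ord.
Qed.

(** * Degrees of points when the coefficients are prescribed modulo p *)

Variables (p : nat) (b : trip m -> int).
Hypothesis p_pr : prime p.
Hypothesis m_gt0 : (0 < m)%N.
Hypothesis lead_p : ~~ (p %| a (ord_max, ord0, ord0))%Z.
Hypothesis irr_p : irreducible_poly (map_poly intr top_form : {poly 'F_p}).
Hypothesis sep_p :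
  coprimep (map_poly intr top_form) ((map_poly intr top_form)^`() : {poly 'F_p}).

Lemma size_top_form : size top_form = m.+1.
Proof.
rewrite size_poly_eq //; apply: contraNneq lead_p.
have -> : inord m = ord_max :> 'I_m.+1 by apply: val_inj; rewrite /= inordK.
rewrite subnn; have -> : inord 0 = ord0 :> 'I_m.+1 by apply: val_inj; rewrite /= inordK.
by move=> ->; apply: dvdz0.
Qed.

Lemma lead_top_form : ~~ (p %| lead_coef top_form)%Z.
Proof.
rewrite lead_coefE size_top_form coef_poly ltnSn /= subnn.
have -> : inord m = ord_max :> 'I_m.+1 by apply: val_inj; rewrite /= inordK.
by have -> : inord 0 = ord0 :> 'I_m.+1 by apply: val_inj; rewrite /= inordK.
Qed.

Lemma exists_valuation_ring_algC : exists V : subringClosed algC,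
  p%:R^-1 \notin V /\ (forall x, x \in V \/ x^-1 \in V).
Proof.
apply: exists_valuation_ring => [z|]; last by rewrite pnatr_eq0 -lt0n prime_gt0.
rewrite -[p%:R]/(p%:Z%:~R) -intrM -[1]/(1%:~R) eqr_int.
apply/eqP => zp; have := prime_gt1 p_pr.
have : (p %| 1%:Z)%Z by rewrite -[1%:Z]/(1 : int) -zp dvdz_mull.
by rewrite dvdz1 absz_nat => /eqP ->.
Qed.

Lemma Dset_degree : Dset (Fform a) m.
Proof.
have [V [Vp Vval]] := exists_valuation_ring_algC.
have irrQ := irreducible_rat p_pr Vval Vp lead_top_form irr_p.
have szQ : size (map_poly intr top_form : {poly rat}) = m.+1.
  rewrite size_map_poly_id0 ?size_top_form // intr_eq0.
  by apply: contraNneq lead_top_form => ->; apply: dvdz0.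
have [L dimL [x fx genx]] := irredp_FAdjoin irrQ.
have mapE : map_poly intr top_form = map_poly (in_alg L) (map_poly intr top_form).
  by rewrite -map_poly_comp; apply: eq_map_poly => z; rewrite -[RHS]/(in_alg L z%:~R) rmorph_int.
rewrite -mapE in fx.
have sz : (size (map_poly intr top_form : {poly L}) <= m.+1)%N.
  by rewrite -size_top_form size_poly.
(* The point (x : 1 : 0) at infinity, with x a root of the top form generating L. *)
pose v (i : 'I_3) : L := if i == 0 then x else if i == 1 then 1 else 0.
have at_infinity (c : trip m -> L) : \sum_(t in M3 m) c t * 0 ^+ t3 t
    = \sum_(t in M3 m | t3 t == 0%N) c t * 0 ^+ t3 t.
  rewrite (bigID (fun t => t3 t == 0%N)) /= addrC big1 ?add0r // => t /andP[_ t0].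
  by rewrite expr0n (negPf t0) mulr0.
exists L, v; split; last by rewrite dimL szQ.
split; first (split; first by exists 1; rewrite /v /= oner_eq0).
  rewrite /mapF meval_Fform at_infinity sum_infinity_hform.
  by rewrite hform_unit ?oner_eq0 // divr1 (rootP fx) mulr0.
split.
  exists 0; rewrite /mapF meval_dx_Fform at_infinity sum_infinity_hform_dx.
  rewrite hform_dx_unit ?oner_eq0 // expr1n mul1r divr1.
  (* Nonsingularity: an irreducible polynomial over the rationals has only simple roots, so the
     x-derivative does not vanish. *)
  have cop : coprimep (map_poly intr top_form) ((map_poly intr top_form)^`() : {poly rat}).
    have d0 : (map_poly intr top_form)^`() != 0 :> {poly rat}.
      apply/negP => /eqP/polyP/(_ m.-1); rewrite coef_deriv coef0 prednK //.
      have -> : (map_poly intr top_form : {poly rat})`_m = lead_coef (map_poly intr top_form).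
        by rewrite lead_coefE szQ.
      move=> /eqP; rewrite mulrn_eq0 lead_coef_eq0 -size_poly_eq0 szQ orbF.
      by rewrite gtn_eqF.
    rewrite irreducible_poly_coprime //; apply/negP => /(dvdp_leq d0).
    by rewrite leqNgt lt_size_deriv // -size_poly_eq0 szQ.
  apply: (coprimep_root _ fx); rewrite mapE deriv_map coprimep_map //.
(* The coordinate 1 puts the scaling factor in K, hence also x, which generates L. *)
move=> K /negP nK [lam [lam0 lamv]]; apply: nK.
have Klam : lam \in K by have := lamv 1; rewrite /v /= mulr1.
have Kx : x \in K by have := lamv 0; rewrite /v /= => h; rewrite -(mulKf lam0 x) rpredM // rpredV.
rewrite -val_eqE /= eqEsubv subvf -genx /=.
by apply/FadjoinP; rewrite sub1v.
Qed.

Hypothesis a_p : forall t, t \in M3 m -> t3 t != 0%N -> a t = p%:Z * b t.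
Hypothesis b_p : ~~ (p %| b (ord0, ord0, ord_max))%Z.

Lemma meval_Fform_split (S : comNzRingType) (v : 'I_3 -> S) :
  (map_mpoly intr (Fform a)).@[v]
  = hform m (map_poly intr top_form) (v 0) (v 1)
    + p%:R * zpart b (v 0) (v 1) (v 2%:R).
Proof.
rewrite meval_Fform (bigID (fun t => t3 t == 0%N)) /= sum_infinity_hform.
congr (_ + _); rewrite /zpart mulr_sumr; apply: eq_bigr => t /andP[tM t0].
by rewrite a_p // intrM !mulrA.
Qed.

Lemma rmorph_zpart (R S : comNzRingType) (phi : {rmorphism R -> S}) x y z :
  phi (zpart b x y z) = zpart b (phi x) (phi y) (phi z).
Proof.
rewrite /zpart rmorph_sum; apply: eq_bigr => t _.
by rewrite !rmorphM !rmorphXn rmorph_int.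
Qed.

Lemma dvd_dim (L : fieldExtType rat) (v : 'I_3 -> L) : (1 < m)%N ->
  on_curve (Fform a) v -> (m %| \dim {:L})%N.
Proof.
move=> m_gt1 [[k vk] Fv].
have [V [Vp Vval]] := exists_valuation_ring_algC.
have sepL : separable 1 {:L}.
  apply/separableP => x _; apply: pcharf0_separable => q.
  by rewrite (pchar_lalg L) pchar_num.
have [al [mu [mon_mu szmu irr_mu _ [gen dvd]]]] := primitive_element_poly sepL.
have /boolp.choice[r rE] (i : 'I_3) := gen (v i).
pose G := hform m (map_poly intr top_form) (r 0) (r 1)
   + p%:R * zpart b (r 0) (r 1) (r 2%:R).
pose at_al : {rmorphism {poly rat} -> L} := horner_eval al \o map_poly (in_alg L).
have intE (R S : comNzRingType) (phi : {rmorphism R -> S}) (q : {poly int}) :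
    map_poly phi (map_poly intr q) = map_poly intr q.
  rewrite -map_poly_comp; apply: eq_map_poly => z.
  by rewrite -[LHS]/(phi z%:~R) rmorph_int.
have GE (S : comNzRingType) (phi : {rmorphism {poly rat} -> S}) :
    phi G = hform m (map_poly intr top_form) (phi (r 0)) (phi (r 1))
      + p%:R * zpart b (phi (r 0)) (phi (r 1)) (phi (r 2%:R)).
  by rewrite /G rmorphD rmorphM rmorph_nat rmorph_hform intE rmorph_zpart.
(* The equation of the curve becomes a divisibility in Q[X], and so holds at every complex root of
   mu, that is, under every embedding of L. *)
have muG : mu %| G.
  rewrite -dvd; apply/rootP; rewrite -[LHS]/(at_al G) GE.
  have rA i : at_al (r i) = v i by rewrite rE.
  by rewrite !rA -meval_Fform_split.
have [s muE] := closed_field_poly_normal (map_poly ratr mu : {poly algC}).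
rewrite lead_coef_map (monicP mon_mu) rmorph1 scale1r in muE.
have size_s : size s = \dim {:L}.
  have : size (map_poly ratr mu : {poly algC}) = (\dim {:L}).+1 by rewrite size_map_poly.
  by rewrite muE size_prod_XsubC => -[].
have dvd_root c (q : {poly rat}) : c \in s -> mu %| q -> root (map_poly ratr q) c.
  move=> cs /dvdpP[w ->]; rewrite rmorphM rootM /= muE.
  by apply/orP; right; rewrite root_prod_XsubC.
rewrite -size_s.
apply: (dvd_conjugates p_pr Vval Vp m_gt1 size_top_form lead_top_form irr_p sep_p b_p
  (a := in_tuple s) (mu := mu) (rx := r 0) (ry := r 1) (rz := r 2%:R)) => //.
move=> c cs x y z; split; last first.
  pose at_c : {rmorphism {poly rat} -> algC} := horner_eval c \o map_poly ratr.
  have /rootP := dvd_root c G cs muG; rewrite -[LHS]/(at_c G) GE => /eqP.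
  by rewrite addr_eq0 => /eqP.
(* A nonzero coordinate is coprime to mu as a polynomial, so none of its conjugates vanishes. *)
have : (map_poly ratr (r k)).[c] != 0.
  have cop : coprimep (map_poly ratr mu) (map_poly ratr (r k) : {poly algC}).
    rewrite coprimep_map irreducible_poly_coprime // -dvd.
    by rewrite /root -rE.
  apply: (coprimep_root cop); rewrite muE root_prod_XsubC //.
have : [|| k == 0, k == 1 | k == 2%:R] by case: (k) => [[|[|[|i]]]].
by case/or3P => /eqP-> h; rewrite /x /y /z h ?orbT.
Qed.

End Points.

(** * Counting *)

Lemma card_family_prod (aT rT : finType) (F : aT -> pred rT) :
  #|(family F : pred {ffun aT -> rT})| = (\prod_(t : aT) #|F t|)%N.
Proof. by rewrite card_family foldrE big_image. Qed.

(** Among 1, ..., B each class modulo 4 has at least B %/ 4 members, and 2B + 1 <= 16 (B %/ 4) once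
    B >= 4. *)
Lemma card_residue (B r : nat) : (4 <= B)%N -> (r < 4)%N ->
  ((2 * B).+1 <= 16 * #|[pred k : 'I_(2 * B).+1 |
     (dec k != 0)%R && (4 %| (dec k - r%:Z)%R)%Z]|)%N.
Proof.
move=> B4 r4; set P := [pred k | _].
(* The class of 0 is started at 4, which keeps the values nonzero. *)
pose e : nat := r == 0%N; pose r' := (r + 4 * e)%N.
have r'0 : (0 < r' <= 4)%N by rewrite /r' /e; case: (r) r4 => [|r0] //=; lia.
have h_ok (j : 'I_(B %/ 4)) : (B + (4 * j + r') < (2 * B).+1)%N.
  by have := ltn_ord j; lia.
pose h j := Ordinal (h_ok j).
have h_inj : injective h.
  by move=> i j /(congr1 val) /= ij; apply: val_inj => /=; lia.
have le_card : (B %/ 4 <= #|P|)%N.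
  rewrite -[X in (X <= _)%N]card_ord -(card_codom h_inj); apply: subset_leq_card.
  apply/subsetP => _ /codomP[j ->]; rewrite inE /dec /=; apply/andP; split.
    by apply/eqP; lia.
  by apply/dvdzP; exists (j%:Z + e%:Z); rewrite /r'; lia.
by lia.
Qed.

Lemma intr_F2_residue (z : int) (x : 'F_2) : (4 %| (z - (x : nat)%:Z)%R)%Z -> z%:~R = x.
Proof.
move=> /dvdzP[k zk]; have -> : z = (2 * k) *+ 2 + (x : nat)%:Z by lia.
rewrite rmorphD rmorphMn -mulr_natr pchar_Zp // mulr0 add0r.
by rewrite /= -pmulrn natr_Zp.
Qed.

(** * Positive proportion from residues prescribed modulo 4 *)

Theorem theorem1p7 (m : nat) (I : {set trip m}) :
  (1 <= m)%N ->
  (forall i j : 'I_m.+1, (i + j)%N = m -> ((i, j, ord0) : trip m) \in I) ->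
  ((ord0, ord0, ord_max) : trip m) \in I ->
  I \subset M3 m ->
  (exists delta : rat, 0 < delta /\
     exists B0 : nat, forall B : nat, (B0 <= B)%N ->
       exists S : {set {ffun trip m -> 'I_(2 * B).+1}},
         S \subset polys_with_support m B I /\
         (forall c, c \in S ->
            is_set_gcd (Dset (Fform (fun t => dec (c t)))) m) /\
         delta * (#|polys_with_support m B I|)%:R <= (#|S|)%:R)
  /\ Gexp [set ((ord_max, ord0, ord0) : trip m);
             ((ord0, ord_max, ord0) : trip m);
             ((ord0, ord0, ord_max) : trip m)] = m.
Proof.
move=> m_gt0 Iinf Izm IM3; split; last first.
  rewrite /Gexp; apply/eqP; rewrite eqn_dvd; apply/andP; split.
    apply: (dvdn_trans (biggcdn_inf (ord_max, ord0, ord0) _ (dvdnn _))).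
      by rewrite !inE eqxx.
    by rewrite /t1 /t2 /t3 /= !gcdn0.
  apply/dvdn_biggcdP => t; rewrite !inE -orbA /t1 /t2 /t3.
  by case/or3P => /eqP-> /=; rewrite ?gcdn0 ?gcd0n.
have [mu [szmu irrmu copmu]] := @exists_irreducible_Fp 2 m isT m_gt0.
pose t0 : trip m := (ord0, ord0, ord_max).
(* On z = 0 the residues lift the coefficients of [mu]. The modulus 4 allows the coefficient of z^m
   to be divisible by 2 exactly once. *)
pose residue (t : trip m) : nat :=
  if t3 t == 0%N then nat_of_ord mu`_(t1 t) else if t == t0 then 2%N else 0%N.
have residue_lt4 t : (residue t < 4)%N.
  rewrite /residue; case: ifP => _; last by case: ifP.
  by apply: leq_trans (ltn_ord _) _.
exists (16 ^+ #|trip m|)^-1; split; first by rewrite invr_gt0 exprn_gt0.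
exists 4 => B B4.
(* Both conditions are imposed coefficient by coefficient, so the two cardinals are products over
   [t], compared factor by factor with a loss of at most 16 each. *)
pose FP (t : trip m) : pred 'I_(2 * B).+1 := fun k => (dec k != 0) == (t \in I).
pose FS (t : trip m) : pred 'I_(2 * B).+1 := fun k => FP t k &&
  ((t \in I) ==> (4 %| (dec k - (residue t)%:Z)%R)%Z).
have polysE c : (c \in polys_with_support m B I) = (c \in family FP).
  rewrite inE; apply/andP/familyP => [[/eqP cI /forallP c0] t|cF].
    rewrite unfold_in -cI !inE; have [tM|tM] := boolP (t \in M3 m); first by rewrite inE in tM; rewrite tM.
    rewrite inE in tM; rewrite (negPf tM) /=.
    by move: (c0 t); rewrite inE tM => /eqP->; rewrite eqxx.
  split.
    apply/eqP/setP => t; rewrite in_set.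
    have /eqP -> : (dec (c t) != 0) == (t \in I) by exact: cF.
    by apply/andb_idl/(subsetP IM3).
  apply/forallP => t; apply/implyP => tM.
  have : (dec (c t) != 0) == (t \in I) by exact: cF.
  by rewrite (negPf (contra (subsetP IM3 t) tM)) eqbF_neg negbK.
exists [set c | c \in family FS]; split.
  apply/subsetP => c; rewrite inE polysE => /familyP cF; apply/familyP => t.
  by have /andP[] : FS t (c t) by exact: cF.
split; last first.
  rewrite mulrC ler_pdivrMr ?exprn_gt0 // -natrX -natrM ler_nat (eq_card polysE) cardsE.
  rewrite !card_family_prod.
  have -> : (\prod_t #|FS t| * 16 ^ #|trip m|)%N = (\prod_t (16 * #|FS t|))%N.
    by rewrite big_split prod_nat_const [LHS]mulnC.
  apply: leq_prod => t _.
  have [tI|tI] := boolP (t \in I); last first.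
    apply: leq_trans (leq_pmull _ (isT : 0 < 16)%N).
    apply/subset_leq_card/subsetP => k FPk; apply/andP; split; first exact: FPk.
    by rewrite (negPf tI).
  apply: leq_trans (max_card _) _; rewrite card_ord.
  apply: leq_trans (card_residue B4 (residue_lt4 t)) _; rewrite leq_mul2l /=.
  apply/subset_leq_card/subsetP => k; rewrite inE => /andP[k0 kr].
  by apply/andP; split; rewrite ?tI // /FP k0 tI.
move=> c; rewrite inE => /familyP cF.
pose a t := dec (c t).
have a_res t : t \in I -> (4 %| (a t - (residue t)%:Z)%R)%Z.
  by move=> tI; have /andP[_] := cF t : FS t (c t); rewrite tI.
have a_0 t : t \notin I -> a t = 0.
  move=> tI; have /andP[] : FS t (c t) by exact: cF.
  by rewrite /FP (negPf tI) eqbF_neg negbK => /eqP.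
have redE : map_poly intr (top_form a) = mu.
  apply/polyP => i; rewrite coef_map coef_poly; case: ltnP => [lti|lei]; last first.
    by rewrite nth_default ?szmu.
  (* All exponents on z = 0 belong to I, so every coefficient of the top form obeys its residue. *)
  have tI : ((inord i, inord (m - i), ord0) : trip m) \in I.
    by apply: Iinf; rewrite !inordK ?ltnS ?leq_subr // subnKC.
  have := a_res _ tI; rewrite /residue /t3 /= ?eqxx /t1 /= inordK //.
  exact: intr_F2_residue.
have lead_a : ~~ (2 %| a (ord_max, ord0, ord0))%Z.
  have tI : ((ord_max, ord0, ord0) : trip m) \in I by apply: Iinf; rewrite addn0.
  rewrite -(Fp_intr_eq0 (isT : prime 2)).
  have := a_res _ tI; rewrite /residue /t3 /= ?eqxx /t1 /= => /intr_F2_residue ->.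
  by rewrite -[m]/(m.+1.-1) -szmu -lead_coefE lead_coef_eq0 -size_poly_eq0 szmu.
pose b t := (a t %/ 2)%Z.
have a_b t : t \in M3 m -> t3 t != 0%N -> a t = 2%:Z * b t.
  move=> _ t30; rewrite mulrC divzK //.
  have [tI|tI] := boolP (t \in I); last by rewrite a_0.
  have := a_res t tI; rewrite /residue (negPf t30).
  by case: ifP => _ /dvdzP[q e]; apply/dvdzP; [exists (q * 2 + 1)|exists (q * 2)]; lia.
have b_odd : ~~ (2 %| b t0)%Z.
  have t0M := subsetP IM3 _ Izm; have t30 : t3 t0 != 0%N by rewrite /t3 /= -lt0n.
  have := a_b t0 t0M t30; have := a_res t0 Izm; rewrite /residue (negPf t30) eqxx.
  by move=> /dvdzP[q e] e'; apply/negP => /dvdzP[q' e'']; lia.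
rewrite -redE in irrmu copmu.
split=> [_ [L [v [[onC _] ->]]]|e]; last first.
  by apply; apply: (Dset_degree (p := 2)).
(* For m = 1 the divisibility is trivial; the local computation takes m > 1. *)
have [m_gt1|m1] := ltnP 1 m; last by have -> : m = 1%N by lia.
exact: (dvd_dim (p := 2) (b := b)) onC.
Qed.
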